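(* There exists a constant $M$ such that the following holds. Let $R,\nu>0$, let $k\ge 2$ and $d\ge1$ be integers, let $\mathcal{A}$ be a finite set, and let $\mathbb{P}$ be a distribution on $B_R(0)\times[k]\times\mathcal{A}$, where $B_R(0)=\{x\in\mathbb{R}^d:\|x\|_2\le R\}$, with $\mathbb{P}[a=\tilde a]\ge\beta>0$ for all $\tilde a\in\mathcal{A}$. Let the training data $\mathcal{D}$ be an i.i.d. sample of size $n$ from $\mathbb{P}$, and let $f=f(\cdot\,;s,\boldsymbol\theta)$ be the threshold model learned from $\mathcal{D}$ by the two-step strategy described in the context, where the linear scoring function $s$ is learned by constrained regularized empirical risk minimization with Ivanov $l_2$-regularization $\|w\|_2^2\le\nu$. Then for any $\gamma>0$ and $0<\delta<1$, for $n$ sufficiently large, with probability at least $1-\delta$ over the training sample $\mathcal{D}$, $$\mathrm{MAE}(f;\mathbb{P})\le\widehat L^{\gamma}_{\mathcal{D}}(s,\boldsymbol\theta)+(k-1)\cdot\sqrt{\frac{M}{n}\left(\frac{R^2\nu}{\gamma^2}\ln(n)+\ln\left(2\,\frac{(k-1)R\sqrt{\nu}}{\gamma\delta}\right)\right)}$$ and $$\text{DP-viol}(f;\mathbb{P})\le\text{DP-viol}(f;\mathcal{D})+Mk^2\cdot\sqrt{\left(d+\log\frac{4|\mathcal{A}|}{\delta}\right)\cdot\left[\left(1-\sqrt{\frac{2\log\frac{4|\mathcal{A}|}{\delta}}{n\beta}}\right)n\beta\right]^{-1}}.$$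
   Context: $[k]=\{1,\dots,k\}$. $M$ is an absolute constant; ''$n$ sufficiently large'' means $n\ge n_0$ where $n_0$ may depend on the other parameters ($\gamma,\delta,R,\nu,k,d,|\mathcal{A}|,\beta$). Threshold model: for $s:\mathbb{R}^d\to\mathbb{R}$ and thresholds $\theta_1\le\dots\le\theta_{k-1}$, $f(x;s,\boldsymbol\theta)=i$ iff $s(x)\in(\theta_{i-1},\theta_i]$, where $\theta_0=-\infty$, $\theta_k=+\infty$. Two-step strategy, given $\mathcal{D}=((x_i,y_i,a_i))_{i=1}^n$: Step 1. Form $\mathcal{D}'=\{(x_i-x_j,\operatorname{sgn}(y_i-y_j),(a_i,a_j)):i,j\in[n],y_i\ne y_j\}$ and learn a linear classifier $c_w(x)=\operatorname{sgn}(w\cdot x)$ by empirical risk minimization of a convex loss on $\mathcal{D}'$, over $w\in\mathbb{R}^d$ with $\|w\|_2^2\le\nu$, subject to approximate fairness: $\max_{\tilde a,\hat a\in\mathcal{A}}|\mathbb{P}_{\mathcal{D}'}[c_w(x')=1\mid a'=(\tilde a,\hat a)]-\mathbb{P}_{\mathcal{D}'}[c_w(x')=1\mid a'=(\hat a,\tilde a)]|\le\varepsilon$ for some chosen $\varepsilon$ (or the same with the probabilities additionally conditioned on $y'=1$), where any existing method for fair linear binary classification may be used to handle the constraint. The scoring function is $s(x)=w\cdot x$ for the resulting $w$; in particular $\|w\|_2\le\sqrt\nu$. Step 2. Choose thresholds $\boldsymbol\theta$ by (exactly, or via local search) minimizing $\frac1n\sum_{i=1}^nC_{y_i,f(x_i;s,\boldsymbol\theta)}+\lambda\cdot\text{Fair-viol}(f(\cdot\,;s,\boldsymbol\theta);\mathcal{D})$,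 where $\lambda\ge0$, $\text{Fair-viol}$ is the violation of the chosen pairwise fairness notion: either $\text{DP-viol}$ defined below, or $\text{EO-viol}(f;\mathcal{D})=\max_{\tilde a,\hat a\in\mathcal{A}}|\mathbb{P}[f(x_1)>f(x_2)\mid a_1=\tilde a,a_2=\hat a,y_1>y_2]-\mathbb{P}[f(x_1)<f(x_2)\mid a_1=\tilde a,a_2=\hat a,y_1<y_2]|$ for two independent uniform draws from $\mathcal{D}$; and $C\in\mathbb{R}_{\ge0}^{k\times k}$ is a cost matrix with $C_{i,i}=0$ and V-shaped rows ($C_{i,j-1}\ge C_{i,j}$ for $2\le j\le i$, $C_{i,j}\le C_{i,j+1}$ for $i\le j\le k-1$). Since $|s(x)|\le R\sqrt\nu$ on $B_R(0)$, the thresholds are taken in $[-R\sqrt\nu,R\sqrt\nu]$. $\mathrm{MAE}(f;\mathbb{P})=\mathbb{E}_{(x,y,a)\sim\mathbb{P}}|y-f(x)|$. $\text{DP-viol}(f;\mathbb{Q})=\max_{\tilde a,\hat a\in\mathcal{A}}|\mathbb{Q}[f(x_1)>f(x_2)\mid a_1=\tilde a,a_2=\hat a]-\mathbb{Q}[f(x_1)<f(x_2)\mid a_1=\tilde a,a_2=\hat a]|$, where $(x_1,y_1,a_1),(x_2,y_2,a_2)$ are independent samples from $\mathbb{Q}$; $\text{DP-viol}(f;\mathcal{D})$ is this quantity for $\mathbb{Q}$ the empirical (uniform) distribution on $\mathcal{D}$. Empirical $\gamma$-margin loss: $\widehat L^\gamma_{\mathcal{D}}(s,\boldsymbol\theta)=\frac1n\sum_{i=1}^n\ell_\gamma(s,\boldsymbol\theta,(x_i,y_i))$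 with $\ell_\gamma(s,\boldsymbol\theta,(x,y))=\sum_{j=1}^{k-1}\mathbf 1\{y^j(s(x)-\theta_j)\le\gamma\}$, where $y^j=+1$ if $j\in\{1,\dots,y-1\}$ and $y^j=-1$ if $j\in\{y,\dots,k-1\}$. *)

(* Defs.v *)
From HB Require Import structures.
From mathcomp Require Import all_boot all_order all_algebra.
From mathcomp Require Import all_classical all_reals all_analysis.

Set Implicit Arguments.
Unset Strict Implicit.
Unset Printing Implicit Defensive.

Import Order.TTheory GRing.Theory Num.Theory.
Import numFieldNormedType.Exports.

Local Open Scope classical_set_scope.
Local Open Scope ring_scope.

(* A finite set with its discrete sigma-algebra. Measurable types are pointed,
   hence the inhabitant [a0], which plays no other role. *)
Definition discrete (A : finType) (a0 : A) : Type := A.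

HB.instance Definition _ (A : finType) (a0 : A) :=
  Finite.copy (discrete a0) A.
HB.instance Definition _ (A : finType) (a0 : A) :=
  isPointed.Build (discrete a0) a0.
HB.instance Definition _ (A : finType) (a0 : A) :=
  @isMeasurable.Build default_measure_display (discrete a0)
    discrete_measurable discrete_measurable0
    discrete_measurableC discrete_measurableU.

(* Observations (x, y, a). Labels are the natural numbers 1, ..., k themselves;
   that y lies in [k] and x in the ball of radius [rad] is a support condition
   on the law of the observation ([supported]). *)
Definition obs (R : realType) (d : nat) (A : finType) (a0 : A) :=
  (d.-tuple R * nat * discrete a0)%type.

Section model.
Variables (R : realType) (d : nat).
Implicit Types (w x : d.-tuple R).

Definition dot w x : R := \sum_(i < d) tnth w i * tnth x i.

Definition norm2 x : R := Num.sqrt (dot x x).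

Definition tsub x x' : d.-tuple R := [tuple tnth x i - tnth x' i | i < d].

Variable k : nat.
Implicit Types (th : k.-1.-tuple R) (s : d.-tuple R -> R).

(* theta_0 = -oo, theta_1, ..., theta_(k-1), theta_k = +oo *)
Definition threshold th (i : nat) : \bar R :=
  if i == 0%N then -oo%E
  else if (i < k)%N then (nth 0 th i.-1)%:E else +oo%E.

(* The i in [k] such that s x belongs to ]theta_(i-1), theta_i]; it is unique
   when th is nondecreasing, see [threshold_modelP] below. *)
Definition threshold_model s th x : nat :=
  head 0%N [seq i <- iota 1 k |
    ((threshold th i.-1 < (s x)%:E) && ((s x)%:E <= threshold th i))%E].

Lemma threshold_homo th : sorted <=%R th ->
  {homo threshold th : i j / (i <= j)%N >-> (i <= j)%E}.
Proof.
move=> sth [|i] [|j] // ij; rewrite /threshold /=; first by rewrite leNye.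
case: (ltnP j.+1 k) => [jk|_]; last by rewrite leey.
rewrite (leq_ltn_trans ij jk) lee_fin.
have size_th l : (l.+1 < k)%N -> (l < size th)%N.
  by rewrite size_tuple ltn_predRL.
apply: (sorted_leq_nth le_trans le_refl) => //; rewrite inE size_th//.
exact: leq_ltn_trans ij jk.
Qed.

Lemma threshold_modelP s th x (i : nat) : sorted <=%R th ->
  (1 <= i <= k)%N ->
  threshold_model s th x = i <->
  ((threshold th i.-1 < (s x)%:E) && ((s x)%:E <= threshold th i))%E.
Proof.
move=> sth /andP[i1 ik].
pose Q j := ((threshold th j.-1 < (s x)%:E) && ((s x)%:E <= threshold th j))%E.
have uQ a b : (0 < a)%N -> (0 < b)%N -> Q a -> Q b -> (b <= a)%N.
  move=> a0 b0 /andP[_ sa] /andP[bs _]; rewrite leqNgt; apply/negP => ab.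
  have := lt_le_trans bs sa; rewrite ltNge threshold_homo//.
  by case: (b) ab.
rewrite /threshold_model -/(Q i) -[[seq _ <- _ | _]]/[seq j <- iota 1 k | Q j].
have memQ j : (j \in [seq j <- iota 1 k | Q j]) = Q j && (0 < j <= k)%N.
  by rewrite mem_filter mem_iota add1n ltnS.
case E : [seq j <- iota 1 k | Q j] => [|h t] /=.
  split; first by move=> i0; rewrite -i0 in i1.
  by move=> Qi; have := memQ i; rewrite E Qi i1 ik.
have /andP[Qh /andP[h0 hk]] : Q h && (0 < h <= k)%N by rewrite -memQ E mem_head.
split; first by move=> <-.
by move=> Qi; apply/eqP; rewrite eqn_leq; apply/andP; split; apply: uQ.
Qed.

(* y^j *)
Definition margin_sign (y j : nat) : R := if (j < y)%N then 1 else -1.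

Definition margin_loss (gamma : R) s th x (y : nat) : R :=
  \sum_(1 <= j < k)
    (margin_sign y j * (s x - nth 0 th j.-1) <= gamma)%R%:R.

End model.

Section fairness.
Variables (R : realType) (d : nat) (A : finType) (a0 : A).
Local Notation Z := (obs R d a0).
Implicit Types (P : probability Z R) (f : d.-tuple R -> nat).

Definition feat (z : Z) : d.-tuple R := z.1.1.
Definition label (z : Z) : nat := z.1.2.
Definition attr (z : Z) : A := z.2.

Definition supported (rad : R) (k : nat) P : Prop :=
  P [set z | (norm2 (feat z) <= rad) && (1 <= label z <= k)%N] = 1%E.

Definition MAE f P : \bar R :=
  'E_P[fun z => `|(label z)%:R - (f (feat z))%:R|].

(* The law of two independent draws, from P and from the uniform distribution
   on the dataset D respectively. *)
Definition pair_law P (E : set (Z * Z)) : R := fine ((P \x P)%E E).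

Definition pair_freq n (D : n.-tuple Z) (E : set (Z * Z)) : R :=
  (\sum_(i < n) \sum_(j < n) \1_E (tnth D i, tnth D j)) / n%:R ^+ 2.

Definition cond_pr T (Q : set T -> R) (E F : set T) : R := Q (E `&` F) / Q F.

(* In both notions the maximum of a finite family of absolute values is taken
   with base value 0. *)
Definition DP_viol f (Q : set (Z * Z) -> R) : R :=
  \big[Num.max/0]_(p : A * A)
    let G := [set z | attr z.1 = p.1 /\ attr z.2 = p.2] in
    `| cond_pr Q [set z | (f (feat z.1) > f (feat z.2))%N] G
       - cond_pr Q [set z | (f (feat z.1) < f (feat z.2))%N] G |.

Definition EO_viol f (Q : set (Z * Z) -> R) : R :=
  \big[Num.max/0]_(p : A * A)
    let G := [set z | attr z.1 = p.1 /\ attr z.2 = p.2] in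
    `| cond_pr Q [set z | (f (feat z.1) > f (feat z.2))%N]
         (G `&` [set z | (label z.1 > label z.2)%N])
       - cond_pr Q [set z | (f (feat z.1) < f (feat z.2))%N]
         (G `&` [set z | (label z.1 < label z.2)%N]) |.

Definition emp_margin_loss k n (gamma : R) (s : d.-tuple R -> R)
    (th : k.-1.-tuple R) (D : n.-tuple Z) : R :=
  (\sum_(i < n) margin_loss gamma s th (feat (tnth D i)) (label (tnth D i)))
    / n%:R.

End fairness.

Variant pairwise_notion := DemographicParity | EqualOpportunity.

(* The free choices of the two-step strategy on datasets of size n.
   - [ps_loss y' t] is the loss at label y' and score t = w . x'.
   - [ps_search D] and [ps_nbhd D w th] describe the optimizers: the weight
     vectors admitted by the method that handles the fairness constraint (any
     restriction or surrogate of that constraint, which need not imply it: the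
     tolerance may then be taken to be 1), and the thresholds against which the
     threshold search compares th. Both equal to [setT] is exact optimization
     in both steps.
   - [ps_cost i j] is C_(i,j) for i, j in {1, ..., k}. *)
Record strategy (R : realType) (d : nat) (A : finType) (a0 : A) (k n : nat) :=
  Strategy {
  ps_loss : R -> R -> R ;
  ps_loss_convex : forall y : R,
    @convex_function R R^o [set: R^o] (ps_loss y) ;
  ps_notion1 : pairwise_notion ;
  ps_tol : R ;
  ps_search : n.-tuple (obs R d a0) -> set (d.-tuple R) ;
  ps_cost : nat -> nat -> R ;
  ps_cost_ge0 : forall i j, (1 <= i <= k)%N -> (1 <= j <= k)%N ->
    0 <= ps_cost i j ;
  ps_cost_diag : forall i, (1 <= i <= k)%N -> ps_cost i i = 0 ;
  ps_cost_left : forall i j, (1 <= i <= k)%N -> (2 <= j <= i)%N ->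
    ps_cost i j <= ps_cost i j.-1 ;
  ps_cost_right : forall i j, (1 <= i <= k)%N -> (i <= j <= k.-1)%N ->
    ps_cost i j <= ps_cost i j.+1 ;
  ps_lambda : R ;
  ps_lambda_ge0 : 0 <= ps_lambda ;
  ps_notion2 : pairwise_notion ;
  ps_nbhd : n.-tuple (obs R d a0) -> d.-tuple R ->
    k.-1.-tuple R -> set (k.-1.-tuple R)
}.

Section two_step.
Variables (R : realType) (d : nat) (A : finType) (a0 : A) (k n : nat).
Local Notation Z := (obs R d a0).
Implicit Types (D : n.-tuple Z) (w : d.-tuple R) (th : k.-1.-tuple R).
Implicit Types (st : strategy R d a0 k n) (p : 'I_n * 'I_n).

(* D' is represented as the family indexed by the pairs (i, j) such that
   y_i <> y_j, so it is counted with multiplicity. *)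
Definition in_pairs D : pred ('I_n * 'I_n) :=
  fun p => label (tnth D p.1) != label (tnth D p.2).

Definition pair_feat D p : d.-tuple R :=
  tsub (feat (tnth D p.1)) (feat (tnth D p.2)).

Definition pair_label D p : R :=
  Num.sg ((label (tnth D p.1))%:R - (label (tnth D p.2))%:R).

Definition pair_attr D p : A * A :=
  (attr (tnth D p.1), attr (tnth D p.2)).

Definition classifier w (x : d.-tuple R) : R := Num.sg (dot w x).

Definition cond_freq (I : finType) (E F : pred I) : R :=
  #|[pred i | E i && F i]|%:R / #|F|%:R.

(* Conditioning events of Step 1, with the additional y' = 1 in the second
   version. *)
Definition step1_cond (nu1 : pairwise_notion) D (ab : A * A) :
    pred ('I_n * 'I_n) := fun p =>
  [&& in_pairs D p, pair_attr D p == ab &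
      if nu1 is EqualOpportunity then pair_label D p == 1 else true].

Definition step1_viol (nu1 : pairwise_notion) D w : R :=
  \big[Num.max/0]_(ab : A * A)
    let E := [pred p | classifier w (pair_feat D p) == 1] in
    `| cond_freq E (step1_cond nu1 D ab)
       - cond_freq E (step1_cond nu1 D (ab.2, ab.1)) |.

Definition step1_risk (loss : R -> R -> R) D w : R :=
  (\sum_(p | in_pairs D p) loss (pair_label D p) (dot w (pair_feat D p)))
    / #|in_pairs D|%:R.

Definition step1_feasible st (nu : R) D : set (d.-tuple R) :=
  [set w | [/\ norm2 w ^+ 2 <= nu, step1_viol (ps_notion1 st) D w <= ps_tol st
             & ps_search st D w]].

Definition step1 st (nu : R) D w : Prop :=
  step1_feasible st nu D w /\
  forall w', step1_feasible st nu D w' ->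
    step1_risk (ps_loss st) D w <= step1_risk (ps_loss st) D w'.

Definition fair_viol (nu2 : pairwise_notion) (f : d.-tuple R -> nat) D : R :=
  match nu2 with
  | DemographicParity => DP_viol f (pair_freq D)
  | EqualOpportunity => EO_viol f (pair_freq D)
  end.

Definition step2_objective st D w th : R :=
  let f := threshold_model (dot w) th in
  (\sum_(i < n) ps_cost st (label (tnth D i)) (f (feat (tnth D i)))) / n%:R
  + ps_lambda st * fair_viol (ps_notion2 st) f D.

Definition step2_feasible (rad nu : R) : set (k.-1.-tuple R) :=
  [set th : k.-1.-tuple R | sorted <=%R th /\
    (forall j, `|tnth th j| <= rad * Num.sqrt nu)].

Definition step2 st (rad nu : R) D w th : Prop :=
  step2_feasible rad nu th /\
  forall th', step2_feasible rad nu th' -> ps_nbhd st D w th th' ->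
    step2_objective st D w th <= step2_objective st D w th'.

(* w and th are a possible outcome of the strategy on D; the learned predictor
   is then [threshold_model (dot w) th]. *)
Definition two_step st (rad nu : R) D w th : Prop :=
  step1 st nu D w /\ step2 st rad nu D w th.

End two_step.

Section sampling.
Variables (R : realType) (dT dO : measure_display).
Variables (T : measurableType dT) (Om : measurableType dO).
Variables (P : probability T R) (Pr : probability Om R) (n : nat).
Variable X : 'I_n -> {RV Pr >-> T}.

Definition mutually_independent : Prop :=
  forall (J : {set 'I_n}) (B : 'I_n -> set T),
    (forall i, measurable (B i)) ->
    Pr (\bigcap_(i in [set` J]) (X i @^-1` B i))
    = (\prod_(i in J) Pr (X i @^-1` B i))%E.

Definition iid_sample : Prop :=
  (forall i (B : set T), measurable B -> distribution Pr (X i) B = P B) /\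
  mutually_independent.

Definition dataset (om : Om) : n.-tuple T := [tuple X i om | i < n].

End sampling.

(* Main.v *)
(* Both bounds follow from one uniform deviation inequality of order
   sqrt (q (d + L) / n), without a logarithm of n and with failure probability
   O (1 / (n q) + exp (- L)), for the sets {z in G | w . x > t} cut out of a
   group G of probability at most q by all half-spaces of R^d. This class has VC
   dimension at most d + 1. On a finite sample space a ghost sample and random
   swaps reduce the deviation to a Rademacher process, which is controlled by
   chaining along nets of size exp (O (V j)) at scale 4^-j (Pajor and Sauer give
   the packing bound); only the 4 n q sample points that fall into G matter,
   which yields the factor q. The general case follows by restricting to finitely
   many half-spaces, which see only finitely many patterns, by continuity from
   below for rational (w, t), and by pointwise approximation for real (w, t).

   For DP, P[f(x1) > f(x2) | a, b] = sum_j u_j(a) (u_(j-1)(b) - u_j(b)) where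
   u_j(a) = P[f > j | a] is a quotient of masses of half-spaces in the group a.
   For MAE, |y - f(x)| counts the thresholds j on the wrong side, and each such
   error is dominated by the margin loss; for n large the term ln n under the root
   beats the n-independent constant of the deviation inequality, so the margin is
   not otherwise exploited. *)

Require Import Defs.
From HB Require Import structures.
From mathcomp Require Import all_boot all_order all_algebra.
From mathcomp Require Import all_classical all_reals all_analysis.
From mathcomp Require Import measurable_realfun ring lra zify.

Set Implicit Arguments.
Unset Strict Implicit.
Unset Printing Implicit Defensive.

Import Order.TTheory GRing.Theory Num.Theory.
Import numFieldNormedType.Exports.

Local Open Scope ring_scope.

(** * Vapnik-Chervonenkis dimension and packing numbers *)

Section vapnik_chervonenkis_dimension.
Import mathcomp.boot.fintype mathcomp.boot.finset.
Local Open Scope set_scope.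
Variable I : finType.
Implicit Types (F G : {set {set I}}) (S T X Y : {set I}).

(** The parity bound dictates the shape of the deviation inequality. It has no ln n, whereas a union
    bound over the polynomially many traces of half-spaces on the sample would lose one; hence
    chaining. It must also be relative to the size of a group: an error of order sqrt (n q (d + L))
    divided by a count of order n q gives sqrt ((d + L) / (n q)), while an error of order sqrt n
    would give 1 / q instead of 1 / sqrt q. The gain comes from discarding sample points outside the
    group, whose number inside is controlled by Chebyshev's inequality alone. Its failure
    probability 1 / (n q) is affordable since n may be large depending on beta and delta. The
    learned w and th depend on the data, so a single event has to serve all half-spaces. Defining it
    by rational half-spaces makes it measurable. Working on a finite sample space turns
    symmetrization and chaining into finite sums and counts of sign patterns. *)

Definition shatters F S :=
  [forall T : {set I}, (T \subset S) ==> [exists X in F, X :&: S == T]].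

Lemma shattersP F S :
  reflect (forall T, T \subset S -> exists2 X, X \in F & X :&: S = T)
          (shatters F S).
Proof.
apply: (iffP forallP) => [FS T TS|FS T].
  have /implyP/(_ TS)/existsP[X /andP[XF /eqP XT]] := FS T.
  by exists X.
apply/implyP => /FS[X XF XT]; apply/existsP; exists X.
by rewrite XF XT eqxx.
Qed.

Lemma shatters_mono F G S : F \subset G -> shatters F S -> shatters G S.
Proof.
move=> /subsetP FG /shattersP FS; apply/shattersP => T /FS[X /FG XG XT].
by exists X.
Qed.

(* Pajor's lemma: splitting F according to whether a given point belongs to its
   members, a set shattered by both halves stays shattered by F after adding
   that point. *)
Lemma card_le_shattered F : (#|F| <= #|[set S | shatters F S]|)%N.
Proof.
have [m] := ubnP #|F|; elim: m F => // m IH F; rewrite ltnS => Fm.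
have [F1|] := leqP #|F| 1.
  have [->|[X XF]] := set_0Vmem F; first by rewrite cards0.
  apply: (leq_trans F1); rewrite card_gt0; apply/set0Pn.
  exists set0; rewrite inE; apply/shattersP => T.
  by rewrite subset0 => /eqP ->; exists X => //; rewrite setI0.
case/card_gt1P => X [Y [XF YF XY]].
have {X Y XF YF XY} [x [X [Y [XF YF xX xY]]]] :
    exists x X Y, [/\ X \in F, Y \in F, x \in X & x \notin Y].
  have : ~~ (X \subset Y) || ~~ (Y \subset X).
    by rewrite -negb_and -eqEsubset.
  by case/orP => /subsetPn[x xX xY]; exists x; [exists X, Y|exists Y, X].
pose F1 := [set Z in F | x \in Z]; pose F0 := [set Z in F | x \notin Z].
have F1F : F1 \subset F by apply/subsetP => Z; rewrite inE => /andP[].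
have F0F : F0 \subset F by apply/subsetP => Z; rewrite inE => /andP[].
have F10 : F = F1 :|: F0.
  by apply/setP => Z; rewrite !inE -andb_orr orbN andbT.
have dF : [disjoint F1 & F0].
  rewrite -setI_eq0; apply/eqP/setP => Z; rewrite !inE.
  by case: (x \in Z); rewrite ?andbF.
have cF : #|F| = (#|F1| + #|F0|)%N.
  by rewrite {1}F10 cardsU disjoint_setI0// cards0 subn0.
have F1_gt0 : (0 < #|F1|)%N.
  by apply/card_gt0P; exists X; rewrite inE XF.
have F0_gt0 : (0 < #|F0|)%N.
  by apply/card_gt0P; exists Y; rewrite inE YF.
have le1 : (#|F1| <= #|[set S | shatters F1 S]|)%N.
  by apply: IH; apply: leq_trans Fm; rewrite cF -addn1 leq_add2l.
have le0 : (#|F0| <= #|[set S | shatters F0 S]|)%N.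
  by apply: IH; apply: leq_trans Fm; rewrite cF -add1n leq_add2r.
(* All members of [F1] contain x and all members of [F0] avoid it, so a set shattered by one half
   omits x. Hence adding x is injective on [S1 :&: S0] and yields sets outside [S1 :|: S0]. *)
have nx1 S : shatters F1 S -> x \notin S.
  move=> /shattersP FS; apply/negP => xS.
  have [Z + Z0] := FS set0 (sub0set _); rewrite inE => /andP[_ xZ].
  by have := congr1 (fun A : {set I} => x \in A) Z0; rewrite !inE xZ xS.
have nx0 S : shatters F0 S -> x \notin S.
  move=> /shattersP FS; apply/negP => xS.
  have [Z + Z0] := FS S (subxx _); rewrite inE => /andP[_ xZ].
  by move: xS; rewrite -Z0 inE (negbTE xZ).
set S1 := [set S | shatters F1 S]; set S0 := [set S | shatters F0 S].
apply: (leq_trans (n := #|S1 :|: S0| + #|S1 :&: S0|)).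
  by rewrite cF cardsUI leq_add.
pose h S := x |: S.
have h_inj : {in S1 :&: S0 &, injective h}.
  move=> S T; rewrite !inE => /andP[/nx1 xS _] /andP[/nx1 xT _] hST.
  by rewrite -(setU1K xS) -(setU1K xT) -/(h S) hST.
rewrite -(card_in_imset h_inj) -cardsUI.
rewrite [X in (_ + X)%N](_ : _ = 0)%N ?addn0; last first.
  apply/eqP; rewrite cards_eq0 -subset0; apply/subsetP => S.
  rewrite inE => /andP[S10 /imsetP[T _ ST]].
  have : x \in S by rewrite ST !inE eqxx.
  by move: S10; rewrite !inE => /orP[/nx1|/nx0]/negbTE ->.
apply: subset_leq_card; apply/subsetP => S; rewrite in_setU => /orP[|/imsetP[T]].
  rewrite !inE => /orP[]; exact: shatters_mono.
rewrite !inE => /andP[T1 T0] ->; apply/shattersP => U UxT.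
have xT := nx1 _ T1.
have [xU|xU] := boolP (x \in U).
  have [|Z + ZT] := shattersP _ _ T1 (U :\ x).
    by rewrite subDset -/(h T).
  rewrite inE => /andP[ZF xZ]; exists Z => //.
  by rewrite /h setIUr ZT (setIidPr _) ?sub1set// setD1K.
have [|Z + ZT] := shattersP _ _ T0 U.
  apply/subsetP => y yU; move/subsetP: UxT => /(_ _ yU); rewrite !inE.
  by case/orP => // /eqP yx; rewrite -yx yU in xU.
rewrite inE => /andP[ZF xZ]; exists Z => //.
rewrite /h setIUr ZT (_ : Z :&: [set x] = set0) ?set0U//.
by apply/setP => y; rewrite !inE; case: eqP => [->|]; rewrite ?(negbTE xZ) ?andbF.
Qed.

(** Points are given by an arbitrary tuple h. A tuple with repetitions is never shattered, since b
    may label equal points differently, so this says that the VC dimension is at most V; the absence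
    of an injectivity condition makes it stable under pullback along any map. *)
Definition vc_family V F := forall h : 'I_V.+1 -> I,
  exists b : 'I_V.+1 -> bool, forall X, X \in F -> exists i, (h i \in X) != b i.

Lemma vc_family_card V F S : vc_family V F -> shatters F S -> (#|S| <= V)%N.
Proof.
move=> vcF /shattersP FS; rewrite leqNgt; apply/negP => VS.
pose h (i : 'I_V.+1) := enum_val (widen_ord VS i).
have hS i : h i \in S by exact: enum_valP.
have h_inj : injective h.
  by move=> i j /enum_val_inj/(congr1 val)/= ij; apply/val_inj.
have [b bF] := vcF h.
have [|X /bF[i hib] XS] := FS [set h i | i in [pred i | b i]].
  by apply/subsetP => _ /imsetP[i _ ->].
move/negP: hib; apply.
have -> : (h i \in X) = (h i \in X :&: S) by rewrite inE hS andbT.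
by rewrite XS mem_imset// inE.
Qed.

End vapnik_chervonenkis_dimension.

Lemma expR_half_le2 (R : realType) : expR (1 / 2) <= 2 :> R.
Proof.
have := @expR_ge1Dx R (- (1 / 2)); rewrite expRN => h.
rewrite -[leRHS]invrK -[leLHS]invrK lef_pV2 ?posrE ?invr_gt0 ?expR_gt0//.
by lra.
Qed.

Section packing.
Import mathcomp.boot.fintype mathcomp.boot.finset.
Local Open Scope set_scope.
Variable R : realType.

(** Sauer's lemma as a generating function: (1 + x)^|I| is the sum of x^|S| over all S, and the
    shattered S, at least |F| in number, contribute at least x^V each. The parameter x is left free
    for [packing_card], which takes x = eps / 4. *)
Lemma sauer (I : finType) V (F : {set {set I}}) (x : R) :
  vc_family V F -> 0 < x <= 1 -> #|F|%:R * x ^+ V <= (1 + x) ^+ #|I|.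
Proof.
move=> vcF /andP[x0 x1].
have -> : (1 + x) ^+ #|I| = \sum_(S : {set I}) x ^+ #|S|.
  rewrite addrC -prodr_const bigA_distr; apply: eq_bigr => S _.
  rewrite (bigID (mem S))/= [X in _ * X]big1 ?mulr1; last first.
    by move=> i /negbTE ->.
  by rewrite (eq_bigr (fun=> x)) ?prodr_const// => i ->.
apply: (@le_trans _ _ (\sum_(S in [set S | shatters F S]) x ^+ V)).
  rewrite sumr_const -[leRHS]mulr_natl ler_wpM2r ?exprn_ge0 ?(ltW x0)//.
  by rewrite ler_nat card_le_shattered.
rewrite [leRHS](bigID (mem [set S | shatters F S]))/= ler_wpDr//.
  by apply: sumr_ge0 => S _; rewrite exprn_ge0 ?(ltW x0).
apply: ler_sum => S; rewrite inE => /(vc_family_card vcF) SV.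
by rewrite ler_wiXn2l ?(ltW x0).
Qed.

Definition pullback (I J : finType) (h : J -> I) (X : {set I}) : {set J} :=
  [set j | h j \in X].

Lemma vc_family_pullback (I J : finType) (h : J -> I) V (F : {set {set I}}) :
  vc_family V F -> vc_family V [set pullback h X | X in F].
Proof.
move=> vcF g; have [b bF] := vcF (h \o g); exists b.
by move=> _ /imsetP[X XF ->]; have [i] := bF _ XF; exists i; rewrite inE.
Qed.

Definition hamming (I : finType) (X Y : {set I}) : nat :=
  #|[set i | (i \in X) != (i \in Y)]|.

Variable I : finType.
Implicit Types (F : {set {set I}}) (D X Y : {set I}).

Lemma hammingC X Y : hamming X Y = hamming Y X.
Proof. by apply: eq_card => i; rewrite !inE eq_sym. Qed.

Lemma hamming_triangle X Y Z : (hamming X Z <= hamming X Y + hamming Y Z)%N.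
Proof.
apply: leq_trans (leq_card_setU _ _).
by apply/subset_leq_card/subsetP => i; rewrite !inE; do !case: (i \in _).
Qed.

(* A uniformly random m-sample of D fails to distinguish a given pair of members
   of F with probability at most (1 - eps)^m. *)
Lemma separating_sample D F (N eps : R) (m : nat) :
  (0 < #|D|)%N -> #|D|%:R <= N -> 0 < eps <= 1 ->
  {in F, forall X, X \subset D} ->
  {in F &, forall X Y, X != Y -> eps * N <= (hamming X Y)%:R} ->
  #|F|%:R ^+ 2 * expR (- (eps * m%:R)) < 1 ->
  exists s : {ffun 'I_m -> I}, {in F &, injective (pullback s)}.
Proof.
move=> D0 DN /andP[e0 e1] FD Fsep Fm.
have [/existsP[s /forall_inP sF]|noS] := boolP [exists s : {ffun 'I_m -> I},
    forall X in F, [forall Y in F, (pullback s X == pullback s Y) ==> (X == Y)]].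
  exists s => X Y XF YF XY; have /forall_inP/(_ _ YF) := sF _ XF.
  by rewrite XY eqxx => /eqP.
exfalso; move: Fm; rewrite ltNge => /negP; apply.
pose ag X Y := [set i in D | (i \in X) == (i \in Y)].
have agE X Y : X \in F -> Y \in F -> X != Y ->
    #|ag X Y|%:R <= (1 - eps) * #|D|%:R.
  move=> XF YF XY.
  have -> : #|ag X Y|%:R = #|D|%:R - (hamming X Y)%:R :> R.
    apply/eqP; rewrite eq_sym subr_eq -natrD eqr_nat; apply/eqP.
    rewrite -(cardsID [set i | (i \in X) == (i \in Y)] D); congr (_ + _)%N.
      by apply: eq_card => i; rewrite !inE.
    apply: eq_card => i; rewrite !inE.
    have [iD|iD] := boolP (i \in D); rewrite ?andbT ?andbF//.
    have /negbTE -> := contra (subsetP (FD _ XF) i) iD.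
    by have /negbTE -> := contra (subsetP (FD _ YF) i) iD.
  rewrite mulrBl mul1r lerD2l lerN2 (le_trans _ (Fsep _ _ XF YF XY))//.
  by rewrite ler_wpM2l ?(ltW e0).
(* Double counting: if every sample fails, each of the |D|^m samples in D can be charged to a pair X
   != Y that it does not distinguish, and such a pair receives at most |ag X Y|^m samples. *)
have : (#|D|%:R ^+ m <= #|F|%:R ^+ 2 * ((1 - eps) * #|D|%:R) ^+ m :> R).
  apply: (@le_trans _ _ (\sum_(X in F) \sum_(Y in F | X != Y)
      (#|ag X Y| ^ m)%:R)); last first.
    rewrite expr2 -mulrA 2!(mulr_natl _ #|F|) -2!sumr_const.
    apply: ler_sum => X XF; rewrite big_mkcondr/=; apply: ler_sum => Y YF.
    case: ifPn => XY; last by rewrite exprn_ge0// mulr_ge0// subr_ge0.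
    by rewrite natrX lerXn2r ?nnegrE ?mulr_ge0 ?subr_ge0// agE.
  under eq_bigr => X _ do rewrite -natr_sum.
  rewrite -natr_sum -natrX ler_nat.
  under eq_bigr => X _ do
    under eq_bigr => Y _ do rewrite -{1}(card_ord m) -card_ffun_on -sum1_card.
  rewrite -{1}(card_ord m) -card_ffun_on -sum1_card.
  pose bad (s : {ffun 'I_m -> I}) X Y := [forall j, (s j \in X) == (s j \in Y)].
  apply: (@leq_trans (\sum_(s in ffun_on D) \sum_(X in F)
      \sum_(Y in F | X != Y) (bad s X Y))).
    apply: leq_sum => s sD; rewrite lt0n; apply: contra noS.
    rewrite sum_nat_eq0 => /forall_inP sF; apply/existsP; exists s.
    apply/forall_inP => X XF; apply/forall_inP => Y YF; apply/implyP => /eqP XY.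
    apply: contraT => XnY; have := sF _ XF.
    rewrite sum_nat_eq0 => /forallP/(_ Y); rewrite YF XnY/= eqb0 => /negP[].
    apply/forallP => j.
    by move/setP/(_ j): XY; rewrite !inE => ->.
  rewrite exchange_big/=; apply: leq_sum => X XF.
  rewrite exchange_big/=; apply: leq_sum => Y _.
  rewrite (eq_bigr (fun s => if bad s X Y then 1 else 0)%N); last first.
    by move=> s _; case: bad.
  rewrite -big_mkcondr/= sum1dep_card sum1_card; apply: subset_leq_card.
  apply/subsetP => s; rewrite inE => /andP[/ffun_onP sD /forallP sXY].
  by apply/ffun_onP => j; rewrite inE sD sXY.
rewrite exprMn mulrA -[leLHS]mul1r ler_pM2r ?exprn_gt0 ?ltr0n//.
move/le_trans; apply; rewrite ler_wpM2l ?exprn_ge0//.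
rewrite -mulNr mulrC expRM_natl; apply: lerXn2r; rewrite ?nnegrE ?expR_ge0//.
  by rewrite subr_ge0.
exact: expR_ge1Dx.
Qed.

(** About 2 ln |F| / eps sample points separate F, and the traces on them still form a family of
    dimension at most V. Sauer's lemma with x = eps / 4 then gives |F| (eps / 4)^V <= e^(1/4) sqrt
    |F|; squaring yields a bound free of |D|, at the price of the exponent 2 V. *)
Lemma packing_card V D F (N eps : R) :
  vc_family V F -> #|D|%:R <= N -> 0 < eps <= 1 ->
  {in F, forall X, X \subset D} ->
  {in F &, forall X Y, X != Y -> eps * N <= (hamming X Y)%:R} ->
  #|F|%:R <= 2 * (4 / eps) ^+ (2 * V).
Proof.
move=> vcF DN e01 FD Fsep; have /andP[e0 e1] := e01.
have e4 : 1 <= 4 / eps by rewrite ler_pdivlMr//; lra.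
have [F1|F1] := leqP #|F| 1.
  apply: (@le_trans _ _ 1); first by rewrite (ler_nat _ _ 1).
  by have := exprn_ege1 (2 * V) e4; lra.
have D0 : (0 < #|D|)%N.
  case/card_gt1P: F1 => X [Y [XF YF]]; rewrite lt0n; apply: contra.
  rewrite cards_eq0 => /eqP D0; have := FD _ XF; have := FD _ YF.
  by rewrite D0 !subset0 => /eqP -> /eqP ->.
pose K : R := #|F|%:R; pose a := ln K.
have K1 : 1 < K by rewrite ltr1n.
have K0 : 0 < K by exact: lt_trans K1.
have Ka : K = expR a by rewrite lnK.
have a0 : 0 <= a by rewrite ln_ge0 ?ltW.
have [m /andP[m1 m2]] :
    exists m : nat, (2 * a / eps < m%:R) && (m%:R <= 2 * a / eps + 1).
  exists (Num.truncn (2 * a / eps)).+1.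
  rewrite truncnS_gt/= -addn1 natrD lerD2r truncn_le//.
  by rewrite divr_ge0 ?mulr_ge0 ?(ltW e0).
have [|s sF] := separating_sample D0 DN e01 FD Fsep (m := m).
  rewrite -/K Ka -expRM_natl -expRD -[ltRHS]expR0 ltr_expR.
  by move: m1; rewrite ltr_pdivrMr//; lra.
have e4' : 0 < eps / 4 <= 1 by lra.
have := sauer (vc_family_pullback s vcF) e4'.
rewrite card_in_imset// card_ord => Km.
have xV : 0 <= (eps / 4) ^+ V by rewrite exprn_ge0// divr_ge0// ltW.
have : K * (eps / 4) ^+ V <= expR (a / 2 + 1 / 4).
  apply: (le_trans Km); apply: (@le_trans _ _ (expR (eps / 4) ^+ m)).
    by rewrite lerXn2r ?nnegrE ?expR_ge0 ?expR_ge1Dx// addr_ge0// divr_ge0// ltW.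
  rewrite -expRM_natl ler_expR.
  have : m%:R * eps <= 2 * a + eps.
    by move: m2; rewrite -(ler_pM2r e0) mulrDl divfK ?gt_eqF// mul1r.
  by clear Km; lra.
have KV0 : 0 <= K * (eps / 4) ^+ V by rewrite mulr_ge0// ltW.
clear Km; move=> /(lerXn2r 2 KV0 (expR_ge0 _)); rewrite exprMn -exprM (mulnC V).
have -> : expR (a / 2 + 1 / 4) ^+ 2 = K * expR (1 / 2).
  by rewrite -expRM_natl Ka -expRD; congr expR; clear; lra.
rewrite (expr2 K) -mulrA ler_pM2l// => KV.
have {}KV := le_trans KV (expR_half_le2 R).
have -> : (4 / eps) ^+ (2 * V) = ((eps / 4) ^+ (2 * V))^-1.
  by rewrite -exprVn invf_div.
by rewrite ler_pdivlMr// exprn_gt0// divr_gt0.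
Qed.

End packing.

(** * Chaining *)

Section rademacher.
Import mathcomp.boot.fintype mathcomp.boot.finset.
Local Open Scope set_scope.
Variable R : realType.

Lemma expR1_ge2 : 2 <= expR 1 :> R.
Proof. by have := @expR_ge1Dx R 1; lra. Qed.

(** The sharp exponent is x^2 / 2. The weaker 2 x^2 follows from 1 + x <= e^x alone; when x >= 1 / 2
    it suffices that x <= 2 x^2. *)
Lemma cosh_le (x : R) : expR x + expR (- x) <= 2 * expR (2 * x ^+ 2).
Proof.
wlog x0 : x / 0 <= x => [wh|].
  have [/wh//|/ltW] := leP 0 x.
  by rewrite -oppr_ge0 => /wh; rewrite opprK addrC sqrrN.
have [x2|x2] := leP (1 / 2) x.
  have : expR x <= expR (2 * x ^+ 2) by rewrite ler_expR; nra.
  have : expR (- x) <= expR (2 * x ^+ 2) by rewrite ler_expR; nra.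
  by lra.
(* expR x <= 1 / (1 - x), so the sum is at most 2 / (1 - x ^ 2) *)
have inv_le (y : R) : y < 1 -> expR y <= (1 - y)^-1.
  move=> y1; rewrite -[leLHS]invrK lef_pV2 ?posrE ?invr_gt0 ?expR_gt0 ?subr_gt0//.
  by rewrite -expRN; apply: expR_ge1Dx.
have h1 := inv_le x ltac:(lra); have h2 := inv_le (- x) ltac:(lra).
apply: (le_trans (lerD h1 h2)).
have -> : (1 - x)^-1 + (1 - - x)^-1 = 2 * (1 - x ^+ 2)^-1.
  by field; apply/and3P; split; apply/eqP; nra.
rewrite ler_pM2l// -[leRHS]invrK lef_pV2 ?posrE ?invr_gt0 ?expR_gt0//; last by nra.
rewrite -[leLHS]mulr1 ler_pdivrMl ?expR_gt0//.
have := @expR_ge1Dx R (2 * x ^+ 2); set e := expR _ => he.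
have : (1 + 2 * x ^+ 2) * (1 - x ^+ 2) <= e * (1 - x ^+ 2).
  by apply: ler_wpM2r => //; nra.
have : 0 <= x ^+ 2 * (1 - 2 * x ^+ 2) by rewrite mulr_ge0 ?sqr_ge0//; nra.
by lra.
Qed.

Variable J : finType.
Implicit Types (s : {ffun J -> bool}) (v : J -> R).

Definition rademacher s v : R := \sum_i (if s i then v i else - v i).

Lemma rademacherB s u v :
  rademacher s u - rademacher s v = rademacher s (fun i => u i - v i).
Proof.
rewrite -sumrB; apply: eq_bigr => i _; case: (s i) => //.
by rewrite opprB opprK addrC.
Qed.

Lemma rademacherN s v : rademacher s (fun i => - v i) = - rademacher s v.
Proof. by rewrite -sumrN; apply: eq_bigr => i _; case: (s i). Qed.

Lemma rademacher_mgf (l : R) v :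
  \sum_s expR (l * rademacher s v)
  <= 2 ^+ #|J| * expR (2 * l ^+ 2 * \sum_i v i ^+ 2).
Proof.
pose F i (b : bool) := expR (l * (if b then v i else - v i)).
have -> : \sum_s expR (l * rademacher s v) = \prod_i \sum_(b : bool) F i b.
  rewrite bigA_distr_bigA; apply: eq_bigr => s _.
  by rewrite mulr_sumr expR_sum.
rewrite mulr_sumr expR_sum -prodr_const -big_split/=; apply: ler_prod => i _.
rewrite big_bool/= /F mulrN addr_ge0 ?expR_ge0//=.
by have := cosh_le (l * v i); rewrite exprMn mulrA.
Qed.

(** Hoeffding's inequality by Chernoff's method, with probabilities written as numbers of sign
    patterns. The choice l = t / (4 W) minimizes 2 l^2 W - l t. *)
Lemma rademacher_tail v (W t : R) : 0 < W -> \sum_i v i ^+ 2 <= W -> 0 <= t ->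
  #|[set s | t <= `|rademacher s v|]|%:R
  <= 2 * (2 ^+ #|J| * expR (- (t ^+ 2 / (8 * W)))).
Proof.
move=> W0 vW t0.
have half u : \sum_i u i ^+ 2 <= W ->
    #|[set s | t <= rademacher s u]|%:R
    <= 2 ^+ #|J| * expR (- (t ^+ 2 / (8 * W))).
  move=> uW; pose l := t / (4 * W).
  have l0 : 0 <= l by rewrite divr_ge0// mulr_ge0// ltW.
  apply: (@le_trans _ _ (\sum_s expR (l * rademacher s u - l * t))).
    rewrite -sum1_card natr_sum big_mkcond/=; apply: ler_sum => s _.
    rewrite inE; case: ifPn => ts; last exact: expR_ge0.
    by rewrite -[leLHS]expR0 ler_expR -mulrBr mulr_ge0// subr_ge0.
  under eq_bigr do rewrite expRD.
  rewrite -mulr_suml; apply: (le_trans (ler_wpM2r (expR_ge0 _) (rademacher_mgf _ _))).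
  rewrite -[leLHS]mulrA ler_pM2l ?exprn_gt0// -expRD ler_expR.
  apply: (@le_trans _ _ (2 * l ^+ 2 * W - l * t)).
    by rewrite lerD2r ler_wpM2l// mulr_ge0// sqr_ge0.
  have -> : 2 * l ^+ 2 * W - l * t = - (t ^+ 2 / (8 * W)).
    by rewrite /l; field; rewrite gt_eqF.
  by [].
have -> : [set s | t <= `|rademacher s v|] =
    [set s | t <= rademacher s v] :|: [set s | t <= rademacher s (fun i => - v i)].
  by apply/setP => s; rewrite !inE rademacherN ler_normr.
apply: (@le_trans _ _ (#|[set s | t <= rademacher s v]|%:R +
    #|[set s | t <= rademacher s (fun i => - v i)]|%:R)).
  by rewrite -natrD ler_nat leq_card_setU.
rewrite mulr_natl mulr2n lerD// half//.
by under eq_bigr do rewrite sqrrN.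
Qed.

End rademacher.

Section chaining.
Import mathcomp.boot.fintype mathcomp.boot.finset.
Local Open Scope set_scope.
Variable R : realType.

(** A maximal separated subfamily is a net, and [packing_card] bounds its size by 2 * 4^(2 V (j +
    1)); 4 <= e^2 gives the exponential form. *)
Lemma net_exists (I : finType) V (D : {set I}) (F : {set {set I}}) (N : R)
    (j : nat) :
  vc_family V F -> #|D|%:R <= N -> {in F, forall X : {set _}, X \subset D} ->
  exists T : {set {set I}}, #|T|%:R <= 2 * expR (4 * V%:R * j.+1%:R) :> R /\
    {in F, forall X : {set _}, exists2 Y, Y \in T & (hamming X Y)%:R <= 4^-1 ^+ j * N}.
Proof.
move=> vcF DN FD; pose eps : R := 4^-1 ^+ j.
have e0 : 0 < eps by rewrite exprn_gt0// invr_gt0.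
have e1 : eps <= 1 by rewrite exprn_ile1// ?invr_ge0// invf_le1// ler1n.
pose P (T : {set {set I}}) := (T \subset F) &&
  [forall X in T, forall Y in T, (X != Y) ==> (eps * N <= (hamming X Y)%:R)].
have [|T /maxsetP[/andP[TF /forall_inP Tsep] Tmax]] := @ex_maxset _ P.
  exists set0; rewrite /P sub0set/=; apply/forall_inP => X; by rewrite inE.
exists T; split.
  apply: (le_trans (packing_card (N := N) (eps := eps) (D := D) (V := V) _ _ _ _ _)) => //.
  - by move=> h; have [b bF] := vcF h; exists b => X /(subsetP TF)/bF.
  - by rewrite e0.
  - by move=> X /(subsetP TF)/FD.
  - by move=> X Y /Tsep/forall_inP XT /XT/implyP.
  rewrite ler_pM2l// /eps -exprVn invrK -exprS -exprM.
  have -> : expR (4 * V%:R * j.+1%:R) = expR 2 ^+ (j.+1 * (2 * V)) :> R.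
    by rewrite -expRM_natl; congr expR; rewrite !natrM; ring.
  rewrite lerXn2r ?nnegrE ?expR_ge0//.
  have -> : expR 2 = expR 1 * expR 1 :> R by rewrite -expRD; congr expR; lra.
  by have := expR1_ge2 R; nra.
move=> X XF; have [XT|XT] := boolP (X \in T).
  exists X => //; rewrite /hamming (_ : [set i | _] = set0) ?cards0.
    by rewrite mulr_ge0 ?(ltW e0)// (le_trans _ DN).
  by apply/setP => i; rewrite !inE eqxx.
have [/existsP[Y /andP[YT /ltW YX]]|/existsPn noY] :=
  boolP [exists Y, (Y \in T) && ((hamming X Y)%:R < eps * N)]; first by exists Y.
have sepX Y : Y \in T -> eps * N <= (hamming X Y)%:R.
  by move=> YT; have := noY Y; rewrite YT/= -leNgt.
case/negP: XT; rewrite -(Tmax (X |: T)) ?setU11 ?subsetUr//.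
apply/andP; split; first by rewrite subUset sub1set XF.
apply/forall_inP => Y /setU1P YT; apply/forall_inP => Z /setU1P ZT.
apply/implyP; case: YT ZT => [->|YT] [->|ZT].
- by rewrite eqxx.
- by move=> _; exact: sepX.
- by move=> _; rewrite hammingC sepX.
- by have /forall_inP/(_ _ ZT)/implyP := Tsep _ YT; apply.
Qed.

Variable J : finType.
Implicit Types (s : {ffun J -> bool}) (X Y : {set J * bool}).

(** [J * bool] indexes a sample together with its ghost copy. Exchanging (i, true) and (i, false)
    flips the sign of the i-th coordinate. *)
Definition pair_diff X (i : J) : R :=
  ((i, true) \in X)%:R - ((i, false) \in X)%:R.

Lemma pair_diff_norm2 X Y :
  \sum_i (pair_diff X i - pair_diff Y i) ^+ 2 <= 2 * (hamming X Y)%:R.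
Proof.
have -> : (hamming X Y)%:R =
    \sum_i \sum_(b : bool) (((i, b) \in X) != ((i, b) \in Y))%:R :> R.
  rewrite pair_bigA/= /hamming -sum1_card natr_sum big_mkcond/=.
  by apply: eq_bigr => -[i b] _; rewrite inE; case: (_ == _).
rewrite mulr_sumr; apply: ler_sum => i _; rewrite big_bool/= /pair_diff.
by case: ((i, true) \in X); case: ((i, true) \in Y);
  case: ((i, false) \in X); case: ((i, false) \in Y) => /=; lra.
Qed.

Lemma geometric_le (q : R) n : 0 <= q < 1 ->
  \sum_(j < n) q ^+ j <= (1 - q)^-1.
Proof.
move=> /andP[q0 q1]; have q1' : 0 < 1 - q by rewrite subr_gt0.
have := subrX1 q n; rewrite -opprB -(opprB 1) mulNr => /oppr_inj h.
rewrite -[leRHS]mulr1 ler_pdivlMl// -h.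
by rewrite lerBlDr lerDl exprn_ge0.
Qed.

(* Dudley's chaining. The net of F at scale 4^-j has at most exp (O (V (j + 1)))
   elements, and the links of level j are controlled up to deviation
   t0 (3 / 4)^(j + 1), which is summable and still beats the union bound. *)
Lemma chaining V (D : {set J * bool}) F (N L : R) :
  vc_family V F -> #|D|%:R <= N -> {in F, forall X : {set _}, X \subset D} ->
  0 < N -> 1 <= L ->
  #|[set s | [exists X in F,
       24 * Num.sqrt (10 * (N * (V%:R + L))) < `|rademacher s (pair_diff X)|]]|%:R
  <= 2 ^+ #|J| * (expR (- L) / 8).
Proof.
move=> vcF DN FD N0 L1.
have VL0 : 0 < V%:R + L by rewrite ltr_wpDl// (lt_le_trans _ L1).
(* 24 = 3 * 8: the link tolerances t0 (3 / 4)^(j + 1) add up to at most 3 t0. *)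
pose t0 := 8 * Num.sqrt (10 * (N * (V%:R + L))).
have t00 : 0 <= t0 by rewrite mulr_ge0 ?sqrtr_ge0.
have t02 : t0 ^+ 2 = 64 * 10 * (N * (V%:R + L)).
  by rewrite exprMn sqr_sqrtr ?mulr_ge0 ?ltW//; ring.
have -> : 24 * Num.sqrt (10 * (N * (V%:R + L))) = 3 * t0 by rewrite /t0; ring.
pose eps j : R := 4^-1 ^+ j.
have [T0 T0P] := choice (fun j => net_exists j vcF DN FD).
(* At scale 1 the empty set is a net, since members of F lie in D and |D| <= N. Its Rademacher sum
   is 0, so the telescoping sum starts from nothing. *)
pose T j := if j is 0%N then [set set0] else T0 j.
have Tcard j : #|T j|%:R <= 2 * expR (4 * V%:R * j.+1%:R) :> R.
  case: j => [|j]; last by case: (T0P j.+1).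
  rewrite cards1 mulr1.
  have : expR 0 <= expR (4 * V%:R) :> R by rewrite ler_expR mulr_ge0.
  by rewrite expR0; lra.
have Tnet j X : X \in F ->
    exists2 Y, Y \in T j & (hamming X Y)%:R <= eps j * N.
  case: j => [|j] XF; last by case: (T0P j.+1) => _ /(_ _ XF).
  exists set0; first by rewrite inE.
  rewrite /eps expr0 mul1r (le_trans _ DN)// ler_nat.
  apply: leq_trans (subset_leq_card (FD _ XF)).
  apply: subset_leq_card; apply/subsetP => i; rewrite !inE.
  by case: (i \in X).
have [p pP] : exists p : nat -> {set J * bool} -> {set J * bool},
    forall j X, X \in F -> p j X \in T j /\ (hamming X (p j X))%:R <= eps j * N.
  have /choice[p pP] : forall jX : nat * {set J * bool}, exists Y,
      jX.2 \in F -> Y \in T jX.1 /\ (hamming jX.2 Y)%:R <= eps jX.1 * N.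
    move=> [j X]; have [XF|] := boolP (X \in F); last by exists set0.
    by have [Y YT XY] := Tnet j _ XF; exists Y.
  by exists (fun j X => p (j, X)) => j X; exact: (pP (j, X)).
pose t j := t0 * (3 / 4) ^+ j.+1.
(* By the triangle inequality, with 5 = 1 + 4 because eps j = 4 * eps j.+1. *)
pose lnk j Y Z := (hamming Y Z)%:R <= 5 * eps j.+1 * N.
pose bad1 j Y Z := [set s |
  t j <= `|rademacher s (pair_diff Y) - rademacher s (pair_diff Z)|].
pose bad j := [set s | [exists Y in T j.+1, [exists Z in T j,
  lnk j Y Z && (s \in bad1 j Y Z)]]].
have bad1_card j Y Z : lnk j Y Z ->
    #|bad1 j Y Z|%:R
    <= 2 * (2 ^+ #|J| * expR (- (8 * (V%:R + L) * j.+2%:R))) :> R.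
  move=> YZ; pose W := 10 * eps j.+1 * N.
  have e0 : 0 < eps j.+1 by rewrite exprn_gt0// invr_gt0.
  have W0 : 0 < W by rewrite !mulr_gt0.
  have t_ge0 : 0 <= t j by rewrite mulr_ge0// exprn_ge0// divr_ge0.
  have -> : bad1 j Y Z = [set s | t j <= `|rademacher s
      (fun i => pair_diff Y i - pair_diff Z i)|].
    by apply/setP => s; rewrite !inE rademacherB.
  have YZW : \sum_i (pair_diff Y i - pair_diff Z i) ^+ 2 <= W.
    apply: (le_trans (pair_diff_norm2 _ _)).
    by move: YZ; rewrite /lnk /W => YZ; lra.
  apply: (le_trans (rademacher_tail W0 YZW t_ge0)).
  rewrite ler_pM2l// ler_pM2l ?exprn_gt0// ler_expR lerN2.
  (* The constant 640 in t0^2 is tuned here: with W = 10 * eps j.+1 * N the exponent is 8 (V + L) (9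
     / 4)^(j + 1) >= 8 (V + L) (j + 2), and the part 8 V (j + 2) pays for the number of links
     between two consecutive nets. *)
  have -> : t j ^+ 2 / (8 * W) = 8 * (V%:R + L) * (9 / 4) ^+ j.+1.
    rewrite /t exprMn t02 /W /eps -exprM mulnC exprM.
    have -> : (3 / 4) ^+ 2 = (9 / 4) * 4^-1 :> R by lra.
    rewrite exprMn -/(eps j.+1); field.
    by rewrite !gt_eqF.
  rewrite ler_pM2l ?mulr_gt0//.
  elim: {+}j.+1 => [|m IH]; first by rewrite expr0.
  by rewrite exprS -natr1; move: IH; rewrite -natr1; have : 0 <= m%:R :> R by []; nra.
have e1 : expR (- 1) <= 1 / 2 :> R.
  rewrite expRN div1r lef_pV2 ?posrE ?expR_gt0//; exact: expR1_ge2.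
have bad_card j : #|bad j|%:R <= 2 ^+ #|J| * (expR (- L) / 16 * (1 / 2) ^+ j).
  apply: (@le_trans _ _ (\sum_(Y in T j.+1) \sum_(Z in T j)
      (2 * (2 ^+ #|J| * expR (- (8 * (V%:R + L) * j.+2%:R)))))).
    apply: (@le_trans _ _ (\sum_(Y in T j.+1) \sum_(Z in T j | lnk j Y Z)
        #|bad1 j Y Z|%:R)); last first.
      apply: ler_sum => Y _; rewrite big_mkcondr/=; apply: ler_sum => Z _.
      by case: ifPn => [/bad1_card//|_]; rewrite !mulr_ge0 ?exprn_ge0 ?expR_ge0.
    have -> : bad j = \bigcup_(Y in T j.+1) \bigcup_(Z in T j | lnk j Y Z) bad1 j Y Z.
      apply/setP => s; rewrite inE; apply/existsP/bigcupP.
        move=> [Y /andP[YT /existsP[Z /and3P[ZT YZ sYZ]]]]; exists Y => //.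
        by apply/bigcupP; exists Z => //; rewrite ZT.
      move=> [Y YT /bigcupP[Z /andP[ZT YZ] sYZ]]; exists Y; rewrite YT/=.
      by apply/existsP; exists Z; rewrite ZT YZ.
    apply: (@le_trans _ _ (\sum_(Y in T j.+1)
        #|\bigcup_(Z in T j | lnk j Y Z) bad1 j Y Z|%:R)).
      rewrite -natr_sum ler_nat; elim/big_ind2 : _ => //; first by rewrite cards0.
      by move=> A a B b Aa Bb; rewrite (leq_trans (leq_card_setU _ _))// leq_add.
    apply: ler_sum => Y _; rewrite -natr_sum ler_nat.
    elim/big_ind2 : _ => //; first by rewrite cards0.
    by move=> A a B b Aa Bb; rewrite (leq_trans (leq_card_setU _ _))// leq_add.
  rewrite !sumr_const -(mulr_natl _ #|T j.+1|) -(mulr_natl _ #|T j|).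
  set a := #|T j.+1|%:R; set b := #|T j|%:R.
  have ab : a * b <= 4 * expR (8 * V%:R * j.+2%:R).
    apply: (@le_trans _ _ ((2 * expR (4 * V%:R * j.+2%:R)) *
        (2 * expR (4 * V%:R * j.+2%:R)))).
      apply: ler_pM => //; first exact: Tcard.
      apply: (le_trans (Tcard _)); rewrite ler_pM2l// ler_expR.
      by rewrite ler_wpM2l ?mulr_ge0// ler_nat.
    rewrite mulrACA -expRD (_ : 2 * 2 = 4 :> R); last by lra.
    by rewrite ler_pM2l// ler_expR; lra.
  rewrite mulrA.
  have -> : forall c d : R, a * b * (2 * (c * d)) = c * (2 * (a * b) * d).
    by move=> c d; ring.
  rewrite ler_pM2l ?exprn_gt0//.
  apply: (@le_trans _ _ (8 * expR (- (8 * L * j.+2%:R)))).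
    have -> : - (8 * (V%:R + L) * j.+2%:R) =
        - (8 * V%:R * j.+2%:R) - 8 * L * j.+2%:R by ring.
    rewrite expRD mulrA ler_wpM2r ?expR_ge0// expRN ler_pdivrMr ?expR_gt0//.
    by lra.
  apply: (@le_trans _ _ (8 * (expR (- L) * (1 / 128 * (1 / 2) ^+ j)))); last first.
    by rewrite le_eqVlt; apply/orP; left; apply/eqP; field.
  rewrite ler_pM2l//.
  (* 8 L (j + 2) >= L + 7 + j as L >= 1. Seven halvings turn the factor 8 into 1 / 16, and the
     remaining powers of 1 / 2 sum to at most 2 over j. *)
  apply: (@le_trans _ _ (expR (- L) * expR (- 1) ^+ (7 + j))).
    rewrite -expRM_natl -expRD ler_expR natrD -(addn2 j) natrD.
    by have : 0 <= j%:R :> R by []; nra.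
  rewrite ler_pM2l ?expR_gt0//.
  apply: (@le_trans _ _ ((1 / 2) ^+ (7 + j))).
    by rewrite lerXn2r ?nnegrE ?expR_ge0// divr_ge0.
  rewrite exprD ler_pM2r ?exprn_gt0 ?divr_gt0//; lra.
(* Hamming distances are integers, so at such a scale the approximation of X is X itself and the
   chain is finite. *)
have [m Nm] : exists m, eps m * N < 1.
  exists (Num.truncn N).+1; rewrite /eps exprVn ltr_pdivrMl ?exprn_gt0// mulr1.
  apply: (lt_trans (truncnS_gt _)); rewrite -natrX ltr_nat.
  exact: ltn_expl.
apply: (@le_trans _ _ (#|\bigcup_(j < m) bad j|%:R)); last first.
  apply: (@le_trans _ _ (\sum_(j < m) #|bad j|%:R)).
    rewrite -natr_sum ler_nat; elim/big_ind2 : _ => //; first by rewrite cards0.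
    by move=> A a B b Aa Bb; rewrite (leq_trans (leq_card_setU _ _))// leq_add.
  apply: (@le_trans _ _ (\sum_(j < m)
      2 ^+ #|J| * (expR (- L) / 16 * (1 / 2) ^+ j))); first exact: ler_sum.
  rewrite -!mulr_sumr ler_pM2l ?exprn_gt0//.
  have q01 : 0 <= (1 / 2 : R) < 1 by lra.
  have := geometric_le m q01; rewrite (_ : (1 - 1 / 2)^-1 = 2); last by field.
  by set S := \sum_(j < m) _; have := expR_gt0 (- L); nra.
rewrite ler_nat; apply: subset_leq_card; apply/subsetP => s.
rewrite inE; apply: contraLR => /bigcupP sgood; apply/existsPn => X.
apply/negP => /andP[XF]; apply/negP; rewrite -leNgt.
have pm : p m X = X.
  have [_ Xm] := pP m _ XF; have : (hamming X (p m X) < 1)%N.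
    by rewrite -(ltr_nat R) (le_lt_trans Xm).
  rewrite ltnS leqn0 cards_eq0 => /eqP/setP Xp; apply/setP => i.
  by have := Xp i; rewrite !inE => /negbFE/eqP.
have rad0 : rademacher s (pair_diff set0) = 0 :> R.
  by apply: big1 => i _; rewrite /pair_diff !inE subrr oppr0 if_same.
have -> : rademacher s (pair_diff X) = \sum_(j < m)
    (rademacher s (pair_diff (p j.+1 X)) - rademacher s (pair_diff (p j X))) :> R.
  rewrite -(big_mkord xpredT (fun j => rademacher s (pair_diff (p j.+1 X))
    - rademacher s (pair_diff (p j X)))) telescope_sumr// pm.
  by have [+ _] := pP 0%N _ XF; rewrite inE => /eqP ->; rewrite rad0 subr0.
apply: (le_trans (ler_norm_sum _ _ _)).
apply: (@le_trans _ _ (\sum_(j < m) t j)).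
  apply: ler_sum => j _; have [//|ltj] := leP.
  exfalso; apply: sgood; exists j => //.
  have [pT Xp] := pP j _ XF; have [pT' Xp'] := pP j.+1 _ XF.
  rewrite inE; apply/existsP; exists (p j.+1 X); rewrite pT'/=.
  apply/existsP; exists (p j X); rewrite pT inE (ltW ltj) andbT/= /lnk.
  have : ((hamming (p j.+1 X) (p j X))%:R <=
      (hamming X (p j.+1 X))%:R + (hamming X (p j X))%:R :> R).
    by rewrite -natrD ler_nat (hammingC X (p j.+1 X)) hamming_triangle.
  have : eps j = 4 * eps j.+1 by rewrite /eps exprS mulrA divff ?mul1r.
  by move=> ej; rewrite ej in Xp; lra.
rewrite /t -mulr_sumr.
under eq_bigr do rewrite exprS.
rewrite -mulr_sumr.
have q01 : 0 <= (3 / 4 : R) < 1 by lra.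
have := geometric_le m q01; rewrite (_ : (1 - 3 / 4)^-1 = 4); last by field.
by set S := \sum_(j < m) _; nra.
Qed.

End chaining.

(** * The uniform deviation inequality on a finite sample space *)

Section finite_sampling.
Import mathcomp.boot.fintype mathcomp.boot.finset.
Local Open Scope set_scope.
Variables (R : realType) (U J : finType) (p : U -> R).
Hypotheses (p_ge0 : forall x, 0 <= p x) (p_sum1 : \sum_x p x = 1).
Implicit Types (u : {ffun J -> U}) (A G : {set U}).

Local Notation n := (#|J|%:R : R).

Definition weight u : R := \prod_i p (u i).
Definition count_in u A : R := \sum_i (u i \in A)%:R.
Definition pmass A : R := \sum_(x in A) p x.

Lemma weight_ge0 u : 0 <= weight u.
Proof. exact: prodr_ge0. Qed.

Lemma sum_weight_prod (h : J -> U -> R) :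
  \sum_u weight u * \prod_i h i (u i) = \prod_i \sum_x p x * h i x.
Proof.
by rewrite bigA_distr_bigA; apply: eq_bigr => u _; rewrite -big_split.
Qed.

Lemma sum_weight : \sum_u weight u = 1.
Proof.
transitivity (\prod_(i : J) \sum_x p x * 1); last first.
  apply: big1 => i _; rewrite -[RHS]p_sum1.
  by apply: eq_bigr => x _; rewrite mulr1.
rewrite -(sum_weight_prod (fun=> fun=> 1)); apply: eq_bigr => u _.
by rewrite big1 ?mulr1.
Qed.

(** By independence ([sum_weight_prod]) a cross term i <> j contains the factor \sum_x p x * g x,
    which vanishes. *)
Lemma sum_weight_variance (g : U -> R) : \sum_x p x * g x = 0 ->
  \sum_u weight u * (\sum_i g (u i)) ^+ 2 = n * \sum_x p x * g x ^+ 2.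
Proof.
move=> g0.
have -> : \sum_u weight u * (\sum_i g (u i)) ^+ 2 =
    \sum_i \sum_j \sum_u weight u * (g (u i) * g (u j)).
  under [RHS]eq_bigr do rewrite exchange_big/=.
  rewrite exchange_big/=; apply: eq_bigr => u _.
  rewrite expr2 mulr_suml mulr_sumr; apply: eq_bigr => i _.
  by rewrite !mulr_sumr.
rewrite mulr_natl -sumr_const; apply: eq_bigr => i _.
rewrite (bigD1 i)//= [X in _ + X]big1 ?addr0 => [|j ji].
  pose h j x := if j == i then g x ^+ 2 else 1.
  transitivity (\sum_u weight u * \prod_j h j (u j)).
    apply: eq_bigr => u _; rewrite (bigD1 i)//= /h eqxx expr2 big1 ?mulr1//.
    by move=> j /negbTE ->.
  rewrite sum_weight_prod (bigD1 i)//= [X in _ * X]big1 ?mulr1 => [|j ji].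
    by apply: eq_bigr => x _; rewrite /h eqxx.
  rewrite -[RHS]p_sum1; apply: eq_bigr => x _.
  by rewrite /h (negbTE ji) mulr1.
pose h l x := if l == i then g x else if l == j then g x else 1.
transitivity (\sum_u weight u * \prod_l h l (u l)).
  apply: eq_bigr => u _; rewrite (bigD1 i)//= (bigD1 j)//= /h (negbTE ji) !eqxx.
  by rewrite big1 ?mulr1// => l /andP[/negbTE -> /negbTE ->].
rewrite sum_weight_prod (bigD1 i)//= [X in X * _](_ : _ = 0) ?mul0r//.
by rewrite -[RHS]g0; apply: eq_bigr => x _; rewrite /h eqxx.
Qed.

Lemma chebyshev_count A (q t : R) : pmass A <= q -> 0 < t ->
  \sum_(u | t <= `|count_in u A - n * pmass A|) weight u <= n * q / t ^+ 2.
Proof.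
move=> Aq t0; pose g x := (x \in A)%:R - pmass A.
have sumA (f : U -> R) : \sum_x f x * (x \in A)%:R = \sum_(x in A) f x.
  rewrite [RHS]big_mkcond/=; apply: eq_bigr => x _.
  by case: (x \in A); rewrite ?mulr1 ?mulr0.
have g0 : \sum_x p x * g x = 0.
  under eq_bigr do rewrite mulrBr.
  by rewrite sumrB sumA -mulr_suml p_sum1 mul1r subrr.
have g2 : \sum_x p x * g x ^+ 2 <= q.
  have -> : \sum_x p x * g x ^+ 2 =
      \sum_x (p x * (x \in A)%:R * (1 - 2 * pmass A) + p x * pmass A ^+ 2).
    by apply: eq_bigr => x _; rewrite /g; case: (x \in A) => /=; ring.
  rewrite big_split/= -!mulr_suml sumA p_sum1 -/(pmass A).
  by have := sqr_ge0 (pmass A); nra.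
have cE u : count_in u A - n * pmass A = \sum_i g (u i).
  by rewrite sumrB sumr_const mulr_natl.
rewrite ler_pdivlMr ?exprn_gt0//.
apply: (@le_trans _ _ (\sum_u weight u * (\sum_i g (u i)) ^+ 2)); last first.
  by rewrite sum_weight_variance// ler_wpM2l.
rewrite mulr_suml big_mkcond/=; apply: ler_sum => u _.
case: ifPn => [tu|_]; last by rewrite mulr_ge0 ?weight_ge0 ?sqr_ge0.
rewrite ler_wpM2l ?weight_ge0// -cE -[leRHS]real_normK ?num_real//.
by rewrite lerXn2r ?nnegrE// ltW.
Qed.

Definition swap (s : {ffun J -> bool}) (uu : {ffun J -> U} * {ffun J -> U}) :=
  ([ffun i => if s i then uu.1 i else uu.2 i],
   [ffun i => if s i then uu.2 i else uu.1 i]).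

Lemma swapK s : involutive (swap s).
Proof.
by case=> u u'; congr (_, _); apply/ffunP => i; rewrite !ffunE; case: (s i).
Qed.

Lemma weight_swap s uu :
  weight (swap s uu).1 * weight (swap s uu).2 = weight uu.1 * weight uu.2.
Proof.
rewrite /weight -!big_split/=; apply: eq_bigr => i _; rewrite !ffunE.
by case: (s i) => //; rewrite mulrC.
Qed.

Definition joint (uu : {ffun J -> U} * {ffun J -> U}) (ib : J * bool) : U :=
  if ib.2 then uu.1 ib.1 else uu.2 ib.1.

(** For a fixed pair uu, the class enters only through its traces on the joint sample and the swap
    only through signs; this is the form that [chaining] accepts. *)
Lemma count_swap s uu A :
  count_in (swap s uu).1 A - count_in (swap s uu).2 A =
  rademacher s (pair_diff R (pullback (joint uu) A)).
Proof.
rewrite /count_in -sumrB; apply: eq_bigr => i _.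
by rewrite !ffunE /pair_diff !inE /joint/=; case: (s i); rewrite ?opprB.
Qed.

Variables (V : nat) (F : {set {set U}}) (q L : R).
Hypotheses (vcF : vc_family V F) (q0 : 0 < q) (Fq : pmass (cover F) <= q).
Hypotheses (J0 : (0 < #|J|)%N) (L1 : 1 <= L).

Let n0 : 0 < n. Proof. by rewrite ltr0n. Qed.
Let nq0 : 0 < n * q. Proof. exact: mulr_gt0. Qed.
Let VL1 : 1 <= V%:R + L. Proof. by rewrite ler_wpDl. Qed.

Let dev : R := 24 * Num.sqrt (10 * (4 * (n * q) * (V%:R + L))).

Let arg_gt0 : 0 < 10 * (4 * (n * q) * (V%:R + L)).
Proof. by rewrite !mulr_gt0//; exact: lt_le_trans VL1. Qed.

Let dev_gt0 : 0 < dev.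
Proof. by rewrite mulr_gt0// sqrtr_gt0. Qed.

(** With this, Chebyshev's inequality keeps the ghost sample within [dev] of its mean with
    probability at least 1 / 2. *)
Let dev_large : 2 * (n * q) <= dev ^+ 2.
Proof.
rewrite exprMn sqr_sqrtr ?(ltW arg_gt0)//.
move: (n * q) nq0 (V%:R + L) VL1 => a a0 b b1.
have ab : a <= a * b by rewrite ler_peMr// ltW.
have a0' : 0 <= a * b by exact: le_trans (ltW a0) ab.
by lra.
Qed.

(** To be heavy the count must exceed its mean, at most n q, by at least n q, while its variance is
    at most n q. *)
Lemma heavy_cover :
  \sum_(u | 2 * (n * q) < count_in u (cover F)) weight u <= (n * q)^-1.
Proof.
have -> : (n * q)^-1 = n * q / (n * q) ^+ 2.
  by field; rewrite !gt_eqF.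
apply: le_trans (chebyshev_count Fq nq0).
rewrite big_mkcond [leRHS]big_mkcond/=; apply: ler_sum => u _.
case: ifPn => [u2|_]; last by case: ifP; rewrite ?weight_ge0.
case: ifPn => // /negP[]; rewrite ler_normr; apply/orP; left.
have : n * pmass (cover F) <= n * q by rewrite ler_pM2l.
by lra.
Qed.

(** The law of the pair of samples is invariant under every swap, so the probability equals its
    average over all s, and for fixed uu one counts the bad s. If both samples are light, the traces
    live on at most 4 n q points and [chaining] applies; otherwise all s are counted, which costs
    [heavy_cover] once for each sample. *)
Lemma symmetrized_bound :
  \sum_(uu : {ffun J -> U} * {ffun J -> U} | [exists A in F,
      dev < `|count_in uu.1 A - count_in uu.2 A|]) weight uu.1 * weight uu.2
  <= 2 * (n * q)^-1 + expR (- L) / 8.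
Proof.
pose B uu := [exists A in F, dev < `|count_in uu.1 A - count_in uu.2 A|].
set S := \sum_(uu | _) _.
have S_swap s : S = \sum_(uu | B (swap s uu)) weight uu.1 * weight uu.2.
  rewrite /S (reindex_inj (inv_inj (swapK s)))/=.
  by apply: eq_bigr => uu _; rewrite weight_swap.
pose heavy uu := (2 * (n * q) < count_in uu.1 (cover F)) ||
  (2 * (n * q) < count_in uu.2 (cover F)).
have p2 : 0 < 2 ^+ #|J| :> R by rewrite exprn_gt0.
suff : 2 ^+ #|J| * S <= 2 ^+ #|J| * (2 * (n * q)^-1 + expR (- L) / 8).
  by rewrite ler_pM2l.
have -> : 2 ^+ #|J| * S = \sum_uu (weight uu.1 * weight uu.2) *
    #|[set s | B (swap s uu)]|%:R.
  transitivity (\sum_(s : {ffun J -> bool}) S).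
    by rewrite sumr_const card_ffun card_bool -[RHS]mulr_natl natrX.
  under eq_bigr => s _ do rewrite (S_swap s) big_mkcond/=.
  rewrite exchange_big/=; apply: eq_bigr => uu _.
  rewrite -big_mkcond/= sumr_const mulr_natr; congr (_ *+ _).
  by apply: eq_card => s; rewrite !inE.
apply: (@le_trans _ _ (\sum_uu (weight uu.1 * weight uu.2) *
    ((heavy uu)%:R * 2 ^+ #|J| + 2 ^+ #|J| * (expR (- L) / 8)))).
  apply: ler_sum => uu _; rewrite ler_wpM2l ?mulr_ge0 ?weight_ge0//.
  have E0 : 0 <= expR (- L) / 8 :> R by rewrite divr_ge0 ?expR_ge0.
  have [_|light] := boolP (heavy uu).
    rewrite mul1r; apply: ler_wpDr; first by rewrite mulr_ge0// ltW.
    by rewrite -natrX ler_nat (leq_trans (max_card _))// card_ffun card_bool.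
  rewrite mul0r add0r.
  have D4 : #|pullback (joint uu) (cover F)|%:R <= 4 * (n * q).
    have -> : #|pullback (joint uu) (cover F)|%:R =
        count_in uu.1 (cover F) + count_in uu.2 (cover F).
      rewrite -big_split/=; transitivity (\sum_i \sum_(b : bool)
          ((if b then uu.1 i else uu.2 i) \in cover F)%:R : R); last first.
        by apply: eq_bigr => i _; rewrite big_bool.
      rewrite pair_bigA/= -sum1_card natr_sum big_mkcond/=.
      by apply: eq_bigr => -[i b] _; rewrite inE /joint/=; case: (_ \in _).
    by move: light; rewrite /heavy negb_or -!leNgt => /andP[]; lra.
  have FD : {in [set pullback (joint uu) A | A in F], forall X : {set _},
      X \subset pullback (joint uu) (cover F)}.
    move=> _ /imsetP[A AF ->]; apply/subsetP => ib; rewrite !inE.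
    by move=> iA; apply/bigcupP; exists A.
  have N0 : 0 < 4 * (n * q) by exact: mulr_gt0.
  have := chaining (vc_family_pullback (joint uu) vcF) D4 FD N0 L1.
  apply: le_trans.
  rewrite ler_nat; apply: subset_leq_card; apply/subsetP => s; rewrite !inE.
  move=> /existsP[A /andP[AF]]; rewrite count_swap => sA.
  by apply/existsP; exists (pullback (joint uu) A); rewrite imset_f.
under eq_bigr do rewrite mulrDr.
have tot : \sum_(uu : {ffun J -> U} * {ffun J -> U}) weight uu.1 * weight uu.2 = 1.
  rewrite -(pair_bigA _ (fun u u' => weight u * weight u'))/=.
  by under eq_bigr do rewrite -mulr_sumr sum_weight mulr1; rewrite sum_weight.
rewrite big_split/= -mulr_suml tot mul1r mulrDr lerD2r.
under eq_bigr do rewrite mulrA.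
rewrite -mulr_suml mulrC ler_pM2l//.
pose H u := (2 * (n * q) < count_in u (cover F)).
apply: (@le_trans _ _ (\sum_(uu : {ffun J -> U} * {ffun J -> U})
    (weight uu.1 * weight uu.2 * (H uu.1)%:R
     + weight uu.1 * weight uu.2 * (H uu.2)%:R))).
  apply: ler_sum => uu _; rewrite -mulrDr ler_wpM2l ?mulr_ge0 ?weight_ge0//.
  by rewrite /heavy -/(H uu.1) -/(H uu.2); case: (H uu.1); case: (H uu.2) => /=; lra.
have HE : \sum_u weight u * (H u)%:R <= (n * q)^-1.
  apply: le_trans heavy_cover; rewrite [leRHS]big_mkcond/=.
  by apply: ler_sum => u _; rewrite /H; case: ifP; rewrite ?mulr1 ?mulr0.
rewrite big_split/= mulr_natl mulr2n; apply: lerD.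
  rewrite -(pair_bigA _ (fun u u' => weight u * weight u' * (H u)%:R))/=.
  apply: le_trans HE; apply: ler_sum => u _.
  by rewrite -mulr_suml -mulr_sumr sum_weight mulr1.
rewrite -(pair_bigA _ (fun u u' => weight u * weight u' * (H u')%:R))/=.
rewrite exchange_big/=.
apply: le_trans HE; apply: ler_sum => u _.
by rewrite -!mulr_suml sum_weight mul1r.
Qed.

(** If A deviates by 2 dev on u, a ghost sample is within dev of its mean on A with probability at
    least 1 / 2, and then the two counts differ by more than dev. Both the deviation and the
    probability in [symmetrized_bound] are therefore doubled. *)
Lemma vc_deviation :
  \sum_(u | [exists A in F,
      48 * Num.sqrt (10 * (4 * (n * q) * (V%:R + L))) <
      `|count_in u A - n * pmass A|]) weight u
  <= 4 * (n * q)^-1 + expR (- L) / 4.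
Proof.
have -> : 48 * Num.sqrt (10 * (4 * (n * q) * (V%:R + L))) = 2 * dev.
  by rewrite /dev; ring.
pose bad u := [exists A in F, 2 * dev < `|count_in u A - n * pmass A|].
pose sep u u' := [exists A in F, dev < `|count_in u A - count_in u' A|].
have half u : bad u -> 1 / 2 <= \sum_(u' | sep u u') weight u'.
  move=> /existsP[A /andP[AF uA]].
  have Aq : pmass A <= q.
    apply: le_trans Fq; rewrite /pmass big_mkcond [leRHS]big_mkcond/=.
    apply: ler_sum => x _; case: ifPn => [xA|_]; last by case: ifP.
    by rewrite ifT//; apply/bigcupP; exists A.
  have := chebyshev_count Aq dev_gt0.
  have : n * q / dev ^+ 2 <= 1 / 2.
    rewrite ler_pdivrMr ?exprn_gt0//; move: dev_large; lra.
  set T := \sum_(u' | _) weight u' => h1 h2.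
  have -> : \sum_(u' | sep u u') weight u' =
      1 - \sum_(u' | ~~ sep u u') weight u'.
    by rewrite -sum_weight [in RHS](bigID (sep u))/= addrK.
  suff : \sum_(u' | ~~ sep u u') weight u' <= T by lra.
  rewrite /T big_mkcond [leRHS]big_mkcond/=; apply: ler_sum => u' _.
  case: ifPn => [su|_]; last by case: ifP; rewrite ?weight_ge0.
  case: ifPn => // /negP[]; rewrite leNgt; apply: contra su => u'A.
  apply/existsP; exists A; rewrite AF/=.
  have := ler_normD (count_in u A - count_in u' A) (count_in u' A - n * pmass A).
  by rewrite addrA subrK; lra.
have : \sum_(u | bad u) weight u * (1 / 2)
    <= 2 * (n * q)^-1 + expR (- L) / 8.
  apply: le_trans symmetrized_bound.
  rewrite big_mkcond/= -(pair_big_dep xpredT (fun u u' => sep u u')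
    (fun u u' => weight u * weight u'))/=.
  apply: ler_sum => u _; case: ifPn => [/half uh|_].
    by rewrite -mulr_sumr ler_wpM2l ?weight_ge0.
  by apply: sumr_ge0 => u' _; rewrite mulr_ge0 ?weight_ge0.
rewrite -mulr_suml -/(bad _).
by lra.
Qed.

End finite_sampling.

(** * The uniform deviation inequality for measurable classes *)

Local Open Scope classical_set_scope.

Section finite_valued.
Variables (R : realType) (d : measure_display) (T : measurableType d).
Variables (mu : probability T R) (U : finType) (g : T -> U).
Hypothesis mg : forall u, measurable (g @^-1` [set u]).

Lemma finite_preimage_bigcup (B : pred U) :
  [set x | B (g x)] = \bigcup_(u in [set` B]) (g @^-1` [set u]).
Proof.
apply/seteqP; split => [x Bx|x [u /= Bu gx]].
  by exists (g x) => //=.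
by move: Bu; rewrite /= -gx.
Qed.

Lemma finite_preimage_measurable (B : pred U) : measurable [set x | B (g x)].
Proof.
by rewrite finite_preimage_bigcup; exact: fin_bigcup_measurable.
Qed.

Lemma finite_preimage_measure (B : pred U) :
  mu [set x | B (g x)] = (\sum_(u | B u) mu (g @^-1` [set u]))%E.
Proof.
rewrite finite_preimage_bigcup measure_fin_bigcup//; last first.
  by move=> u v _ _ [x [/= <- <-]].
rewrite -big_enum/= [RHS]fsbig_seq ?enum_uniq//.
rewrite (_ : [set` enum B] = [set` B])//.
by apply/seteqP; split => u /=; rewrite mem_enum.
Qed.

End finite_valued.

Definition vc_class (T K : Type) (A : K -> pred T) (V : nat) : Prop :=
  forall h : 'I_V.+1 -> T, exists b : 'I_V.+1 -> bool,
  forall k, exists i, A k (h i) != b i.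

Section vc_inequality.
Variables (R : realType) (dT dO : measure_display).
Variables (T : measurableType dT) (Om : measurableType dO).
Variables (P : probability T R) (Pr : probability Om R) (n : nat).
Variable Z : 'I_n -> {RV Pr >-> T}.
Hypothesis iidZ : iid_sample P Z.

Definition hits (a : pred T) (om : Om) : R := \sum_(i < n) (a (Z i om))%:R.

Definition mass (a : pred T) : R := fine (P [set x | a x]).

Section finite_quotient.
Variables (U : finType) (g : T -> U).
Hypothesis mg : forall u, measurable (g @^-1` [set u]).

Let p u : R := fine (P (g @^-1` [set u])).
Let pat (om : Om) : {ffun 'I_n -> U} := [ffun i => g (Z i om)].

Let mpat u : measurable (pat @^-1` [set u]).
Proof.
have -> : pat @^-1` [set u] = \bigcap_(i in [set: 'I_n]) (Z i @^-1` (g @^-1` [set u i])).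
  apply/seteqP; split => [om /= <- i _|om h]; first by rewrite /= ffunE.
  by apply/ffunP => i; rewrite ffunE; exact: h.
apply: fin_bigcap_measurable; first exact: finite_finset.
by move=> i _; rewrite -[X in measurable X]setTI; exact: measurable_funP.
Qed.

Let Pr_pat u : Pr (pat @^-1` [set u]) = (weight p u)%:E.
Proof.
have -> : pat @^-1` [set u] =
    \bigcap_(i in [set` [set: 'I_n]%SET]) (Z i @^-1` (g @^-1` [set u i])).
  apply/seteqP; split => [om /= <- i _|om h]; first by rewrite /= ffunE.
  by apply/ffunP => i; rewrite ffunE; apply: h; rewrite /= inE.
have [lawZ indZ] := iidZ.
rewrite indZ// /weight -prodEFin; apply: eq_big => [i|i _]; first by rewrite inE.
rewrite /p fineK; last exact: fin_num_measure.
by rewrite -(lawZ i _ (mg (u i))).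
Qed.

Lemma finite_law (B : pred {ffun 'I_n -> U}) :
  measurable [set om | B (pat om)] /\
  Pr [set om | B (pat om)] = (\sum_(u | B u) weight p u)%:E.
Proof.
split; first exact: finite_preimage_measurable.
rewrite finite_preimage_measure// -sumEFin.
by apply: eq_bigr => u _; exact: Pr_pat.
Qed.

Lemma finite_mass (B : pred U) : mass (B \o g) = \sum_(u | B u) p u.
Proof.
apply: EFin_inj; rewrite -sumEFin /mass fineK; last first.
  exact/fin_num_measure/finite_preimage_measurable.
rewrite (finite_preimage_measure P mg); apply: eq_bigr => u _.
by rewrite fineK//; exact: fin_num_measure.
Qed.

End finite_quotient.

Variables (A : nat -> pred T) (V : nat) (q L : R).
Hypotheses (mA : forall k, measurable [set x | A k x]) (vcA : vc_class A V).
Hypotheses (q0 : 0 < q) (Aq : (P (\bigcup_k [set x | A k x]) <= q%:E)%E).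
Hypotheses (n0 : (0 < n)%N) (L1 : 1 <= L).

Let dev : R := 48 * Num.sqrt (10 * (4 * (n%:R * q) * (V%:R + L))).
Let bad k : set Om := [set om | dev < `|hits (A k) om - n%:R * mass (A k)|].

Section first_K.
Import mathcomp.boot.fintype mathcomp.boot.finset.
Variable K : nat.

(** Each of the first K sets is the preimage under g of a set of patterns, so its counts and its
    mass can be computed on the finite space of patterns. *)
Let g (x : T) : {set 'I_K} := [set k : 'I_K | A k x]%SET.

Let mg u : measurable (g @^-1` [set u]%classic).
Proof.
have -> : g @^-1` [set u]%classic =
    (\bigcap_(k in [set: 'I_K]%classic) [set x | A k x == (k \in u)])%classic.
  apply/seteqP; split => [x /= <- k _|x h]; first by rewrite /= inE.
  by apply/setP => k; rewrite inE; apply/eqP; exact: h.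
apply: fin_bigcap_measurable; first exact: finite_finset.
move=> k _; case: (k \in u).
  rewrite (_ : [set _ | _]%classic = [set x | A k x]%classic)//.
  by apply/seteqP; split => x /= /eqP.
rewrite (_ : [set _ | _]%classic = (~` [set x | A k x])%classic).
  exact: measurableC.
by apply/seteqP; split => x /=; [move/eqP => ->|move/negP/negbTE ->].
Qed.

(* Only the attained patterns are kept, so that a family of points of the
   quotient lifts to T and the bound on the VC dimension passes to c. *)
Let c (k : 'I_K) : {set {set 'I_K}} :=
  [set u : {set 'I_K} | (k \in u) && `[< exists x, g x = u >]]%SET.

Let gc k x : (g x \in c k) = A k x.
Proof.
by rewrite !inE andb_idr// => _; apply/asboolP; exists x.
Qed.

Let F : {set {set {set 'I_K}}} := [set c k | k in 'I_K]%SET.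

Let vcF : vc_family V F.
Proof.
move=> h; have [himg|] := pselect (forall i, exists x, g x = h i).
  have [y yh] := choice himg; have [b bA] := vcA y.
  exists b => _ /imsetP[k _ ->]; have [i] := bA k.
  by exists i; rewrite -yh gc.
move=> /existsNP[i nhi]; exists (fun=> true) => _ /imsetP[k _ ->]; exists i.
by rewrite inE (asboolF nhi) andbF.
Qed.

Let p u : R := fine (P (g @^-1` [set u]%classic)).

Let p_ge0 u : 0 <= p u. Proof. by rewrite fine_ge0. Qed.

Let p_sum1 : \sum_u p u = 1.
Proof.
rewrite -(finite_mass mg xpredT) /mass (_ : [set _ | _]%classic = classical_sets.setT) ?probability_setT//.
by apply/seteqP; split.
Qed.

Let pFq : pmass p (cover F) <= q.
Proof.
rewrite /pmass -(finite_mass mg (mem (cover F))) /mass -lee_fin fineK; last first.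
  by apply: fin_num_measure; exact: (finite_preimage_measurable mg (mem (cover F))).
apply: le_trans Aq; apply: le_measure.
- exact/mem_set/(finite_preimage_measurable mg (mem (cover F))).
- exact/mem_set/bigcup_measurable.
move=> x /= /bigcupP[_ /imsetP[k _ ->]]; rewrite gc => Akx.
by exists k.
Qed.

Lemma vc_deviation_first :
  measurable (\bigcup_(k in `I_K) bad k)%classic /\
  (Pr (\bigcup_(k in `I_K) bad k)%classic <=
    (4 * (n%:R * q)^-1 + expR (- L) / 4)%:E)%E.
Proof.
pose B (u : {ffun 'I_n -> {set 'I_K}}) := [exists X in F,
  dev < `|count_in R u X - n%:R * pmass p X|].
have -> : (\bigcup_(k in `I_K) bad k = [set om | B [ffun i => g (Z i om)]])%classic.
  have cE (k : 'I_K) om : `|count_in R [ffun i => g (Z i om)] (c k)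
      - n%:R * pmass p (c k)| = `|hits (A k) om - n%:R * mass (A k)|.
    congr (`| _ - _ * _ |).
      by apply: eq_bigr => i _; rewrite ffunE gc.
    rewrite /pmass -(finite_mass mg (mem (c k))).
    by congr (fine (P _)); apply/seteqP; split => x /=; rewrite gc.
  apply/seteqP; split => [om [k /= kK badk]|om /existsP[_ /andP[/imsetP[k _ ->]]]].
    apply/existsP; exists (c (Ordinal kK)); rewrite imset_f//=.
    by rewrite cE.
  by rewrite cE => badk; exists k => /=.
have [mB PrB] := finite_law mg B; split => //.
rewrite PrB lee_fin.
have J0 : (0 < #|'I_n|)%N by rewrite card_ord.
have := vc_deviation p_ge0 p_sum1 vcF q0 pFq J0 L1.
by rewrite card_ord.
Qed.

End first_K.

Theorem vc_inequality :
  measurable (\bigcup_k bad k) /\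
  (Pr (\bigcup_k bad k) <= (4 * (n%:R * q)^-1 + expR (- L) / 4)%:E)%E.
Proof.
pose D K := \bigcup_(k in `I_K) bad k.
have DE : \bigcup_k bad k = \bigcup_K D K.
  apply/seteqP; split => om [k _ badk].
    by exists k.+1 => //; exists k => /=.
  by case: badk => j _ badj; exists j.
have mD K : measurable (D K) by case: (vc_deviation_first K).
have mU : measurable (\bigcup_K D K) by exact: bigcup_measurable.
rewrite DE; split => //.
have ndD : nondecreasing_seq D.
  move=> i j ij; apply/subsetPset => om [k /= ki badk]; exists k => //=.
  exact: leq_trans ki ij.
have := nondecreasing_cvg_mu (mu := Pr) mD mU ndD.
move=> /cvg_lim <-//; apply: lime_le.
  by apply: ereal_nondecreasing_is_cvgn => i j ij; apply: le_measure;
    rewrite ?inE//; apply/subsetPset; exact: ndD.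
by apply: nearW => K /=; case: (vc_deviation_first K).
Qed.

End vc_inequality.

(** * Half-spaces *)

Section halfspaces.
Variables (R : realType) (d : nat) (A : finType) (a0 : A).
Local Notation T := (obs R d a0).
Variable G : pred T.

(** The inequality is strict, as in f > j iff theta_j < s. Since w = 0 is allowed, the whole group G
    is one of these sets. *)
Definition halfspace (wt : d.-tuple R * R) : pred T :=
  fun z => G z && (wt.2 < dot wt.1 (feat z)).

(* d + 2 points of R^d satisfy an affine dependency; the set of points with a
   positive coefficient is not cut out by any half-space. *)
Lemma halfspace_vc : vc_class halfspace d.+1.
Proof.
move=> h; have [hG|] := pselect (forall i, G (h i)); last first.
  move=> /existsNP[i /negP/negbTE nG]; exists (fun=> true) => wt; exists i.
  by rewrite /halfspace nG.
pose X := \matrix_(i < d.+2, l < d) tnth (feat (h i)) l.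
(* The column of ones makes a left kernel vector an affine dependency; d + 2 rows and d + 1 columns
   guarantee a nonzero one. *)
pose M : 'M[R]_(d.+2, d + 1) := row_mx X (const_mx 1).
have [c /sub_kermxP cM c0] : exists2 c : 'rV_d.+2, (c <= kermx M)%MS & c != 0.
  apply/rowV0Pn; rewrite kermx_eq0 /row_free neq_ltn.
  by rewrite (leq_ltn_trans (rank_leq_col M))// addn1.
exists (fun i => 0 < c 0 i) => -[w t]; apply/existsP; apply: contraT.
rewrite negb_exists => /forallP eqb.
have {}eqb i : (t < dot w (feat (h i))) = (0 < c 0 i).
  by have := eqb i; rewrite negbK /halfspace hG => /eqP.
have [cX c1] : c *m X = 0 /\ c *m const_mx 1 = 0 :> 'rV_1.
  by apply: eq_row_mx; rewrite -mul_mx_row cM row_mx0.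
have sum_c : \sum_i c 0 i = 0.
  have := congr1 (fun B : 'rV_1 => B 0 0) c1; rewrite !mxE => c1'.
  by rewrite -[RHS]c1'; apply: eq_bigr => i _; rewrite mxE mulr1.
have sum_cx : \sum_i c 0 i * (dot w (feat (h i)) - t) = 0.
  under eq_bigr do rewrite mulrBr.
  rewrite sumrB -mulr_suml sum_c mul0r subr0.
  under eq_bigr do rewrite mulr_sumr.
  rewrite exchange_big/= big1// => l _.
  have := congr1 (fun B : 'rV_d => B 0 l) cX; rewrite !mxE => cXl.
  transitivity (tnth w l * \sum_i c 0 i * X i l); last by rewrite cXl mulr0.
  by rewrite mulr_sumr; apply: eq_bigr => i _; rewrite mxE; ring.
(* If a half-space realized the signs of c, every term would be nonnegative, and positive where c
   is; as they sum to 0, no coefficient is positive, and \sum c = 0 then forces c = 0. *)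
have term_ge0 i : 0 <= c 0 i * (dot w (feat (h i)) - t).
  have := eqb i; have [ci|ci] := ltP 0 (c 0 i).
    by move=> ti; rewrite mulr_ge0 ?subr_ge0 ?(ltW ci)// ltW.
  by move=> /negbT; rewrite -leNgt => ti; rewrite mulr_le0// subr_le0.
have c_le0 i : c 0 i <= 0.
  rewrite leNgt; apply/negP => ci.
  move/eqP: sum_cx; rewrite psumr_eq0// => /allP/(_ i (mem_index_enum _)).
  by apply/negP; rewrite gt_eqF// mulr_gt0// subr_gt0 eqb.
case/eqP: c0; apply/rowP => i; rewrite mxE; apply/eqP.
move/eqP: sum_c; rewrite -oppr_eq0 -sumrN psumr_eq0; last first.
  by move=> j _; rewrite oppr_ge0.
by move=> /allP/(_ i (mem_index_enum _)); rewrite oppr_eq0.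
Qed.

(** The rational thresholds approach t from above, at distance between e and 2 e, while w is
    approximated to order e^2. Boundary points w . x = t thus stay excluded, and points beyond the
    boundary are eventually included. *)
Lemma halfspace_rat_approx (w : d.-tuple R) (t : R) :
  exists u : nat -> d.-tuple rat * rat, forall z, exists N, forall m, (N <= m)%N ->
    halfspace ([tuple ratr (tnth (u m).1 l) | l < d], ratr (u m).2) z =
    halfspace (w, t) z.
Proof.
pose e (m : nat) : R := m.+1%:R^-1.
have e0 m : 0 < e m by rewrite invr_gt0 ltr0n.
have rat_near (x y : R) : x < y -> exists r : rat, x < ratr r < y.
  by move=> /rat_in_itvoo[r]; rewrite in_itv/= => xry; exists r.
have /choice[u uP] : forall m, exists v : d.-tuple rat * rat,
    (forall l, `|ratr (tnth v.1 l) - tnth w l| <= e m ^+ 2) /\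
    t + e m < ratr v.2 < t + 2 * e m.
  move=> m.
  have /choice[f fP] : forall l, exists r : rat,
      tnth w l - e m ^+ 2 < ratr r < tnth w l + e m ^+ 2.
    move=> l; apply: rat_near.
    by have := exprn_gt0 2 (e0 m); lra.
  have [s sP] : exists s : rat, t + e m < ratr s < t + 2 * e m.
    by apply: rat_near; have := e0 m; lra.
  exists ([tuple f l | l < d], s); split => // l /=; rewrite tnth_mktuple.
  by rewrite ler_distl; have := fP l; lra.
exists u => z; pose x := feat z; pose S := \sum_(l < d) `|tnth x l|.
have S0 : 0 <= S by exact: sumr_ge0.
have close m : `|dot [tuple ratr (tnth (u m).1 l) | l < d] x - dot w x|
    <= e m ^+ 2 * S.
  rewrite /dot -sumrB mulr_sumr; apply: (le_trans (ler_norm_sum _ _ _)).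
  apply: ler_sum => l _; rewrite tnth_mktuple -mulrBl normrM ler_wpM2r//.
  by case: (uP m).
pose y := `|dot w x - t|.
(* m + 1 > S bounds the error of the scalar product by e m, and m + 1 > 3 / y gives 3 * e m < y. For
   y = 0 the quotient is 0 by convention; this falls under w . x <= t, where the first bound
   suffices. *)
exists (Num.truncn (S + 3 / y)) => m Nm; rewrite /halfspace/= -/x.
congr (_ && _); have /andP[t1 t2] := (uP m).2.
have := close m; rewrite ler_distl => /andP[c1 c2].
have Sm : S + 3 / y < m.+1%:R.
  by apply: lt_le_trans (truncnS_gt _) _; rewrite ler_nat.
have y30 : 0 <= 3 / y by rewrite divr_ge0 ?normr_ge0.
have emK : e m * m.+1%:R = 1 by rewrite mulVf// pnatr_eq0.
have eS : e m ^+ 2 * S <= e m.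
  have : e m * S <= e m * m.+1%:R by rewrite ler_pM2l//; lra.
  by rewrite emK expr2 -mulrA ger_pMr.
have [tw|wt] := ltP t (dot w x).
  have y0 : 0 < y by rewrite normr_gt0 subr_eq0 gt_eqF.
  have ye : 3 * e m < y.
    have : e m * (3 / y) < e m * m.+1%:R by rewrite ltr_pM2l//; lra.
    by rewrite emK mulrA ltr_pdivrMr// mul1r mulrC.
  have yE : y = dot w x - t by rewrite /y ger0_norm// subr_ge0 ltW.
  by apply: lt_le_trans c1; lra.
by apply/negbTE; rewrite -leNgt; apply: (le_trans c2); lra.
Qed.

End halfspaces.

(** * Convergence of masses under pointwise stabilization *)

Section mass_limit.
Variables (R : realType) (dT : measure_display) (T : measurableType dT).
Variable P : probability T R.

Lemma mass_fin (a : pred T) : measurable [set z | a z] ->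
  P [set z | a z] = (mass P a)%:E.
Proof. by move=> ma; rewrite /mass fineK// fin_num_measure. Qed.

Lemma massU_le (a b c : pred T) : measurable [set z | a z] ->
  measurable [set z | b z] -> measurable [set z | c z] ->
  (forall z, a z -> b z || c z) -> mass P a <= mass P b + mass P c.
Proof.
move=> ma mb mc abc; rewrite -lee_fin EFinD -!mass_fin//.
apply: le_trans (measureU2 P mb mc); apply: le_measure; rewrite ?inE//.
  exact: measurableU.
by move=> z /= /abc/orP[]; [left|right].
Qed.

(** The points where some a_ m with m >= N still differs from a form decreasing sets with empty
    intersection, so continuity from above applies. *)
Lemma mass_stable (a_ : nat -> pred T) (a : pred T) (eta : R) :
  (forall m, measurable [set z | a_ m z]) -> measurable [set z | a z] ->
  (forall z, exists N, forall m, (N <= m)%N -> a_ m z = a z) -> 0 < eta ->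
  exists N, forall m, (N <= m)%N -> `|mass P (a_ m) - mass P a| <= eta.
Proof.
move=> ma_ ma aE eta0.
pose dif N : pred T := fun z => `[< exists2 m, (N <= m)%N & a_ m z != a z >].
have difE N : [set z | dif N z] =
    \bigcup_(m in [set m | (N <= m)%N]) [set z | a_ m z != a z].
  by apply/seteqP; split => z /=; [move/asboolP => [m Nm ?]; exists m|
    move=> [m /= Nm ?]; apply/asboolP; exists m].
have mdif N : measurable [set z | dif N z].
  rewrite difE; apply: bigcup_measurable => m _.
  rewrite (_ : [set _ | _] = ([set z | a_ m z] `\` [set z | a z]) `|`
      ([set z | a z] `\` [set z | a_ m z])).
    by apply: measurableU; exact: measurableD.
  apply/seteqP; split => z /=.
    by case: (a_ m z); case: (a z) => //= _; [left|right]; split.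
  by move=> []; case: (a_ m z); case: (a z) => //= -[].
have dif0 : \bigcap_N [set z | dif N z] = set0.
  apply/seteqP; split => // z zdif; have [N Nz] := aE z.
  by have /asboolP[m /Nz ->] := zdif N I; rewrite eqxx.
have := @nonincreasing_cvg_mu _ _ _ P (fun N => [set z | dif N z]).
rewrite dif0 measure0 => cvg0.
have {}cvg0 : (fun N => (mass P (dif N))%:E) @ \oo --> 0%E.
  have <- : P \o (fun N => [set z | dif N z]) = (fun N => (mass P (dif N))%:E).
    by apply/funext => N /=; rewrite mass_fin.
  apply: cvg0 => //.
    by rewrite -[ltLHS]/(P _) mass_fin// ltry.
  move=> i j ij; apply/subsetPset => z /= /asboolP[m jm ?].
  by apply/asboolP; exists m => //; exact: leq_trans jm.
have /fine_cvgP[_ /cvgrPdist_le/(_ _ eta0)[N _ NP]] := cvg0.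
exists N => m Nm; have := NP N (leqnn N); rewrite /= sub0r normrN => difN.
have {}difN : mass P (dif N) <= eta by apply: le_trans difN; exact: ler_norm.
have h1 : mass P (a_ m) <= mass P a + mass P (dif N).
  apply: massU_le => // z amz; apply/orP; case: (boolP (a z)) => az; [by left|right].
  by apply/asboolP; exists m => //; rewrite amz (negbTE az).
have h2 : mass P a <= mass P (a_ m) + mass P (dif N).
  apply: massU_le => // z az; apply/orP; case: (boolP (a_ m z)) => amz; [by left|right].
  by apply/asboolP; exists m => //; rewrite az (negbTE amz).
by rewrite ler_distl; lra.
Qed.

End mass_limit.

Section halfspace_deviation.
Variables (R : realType) (d : nat) (A : finType) (a0 : A).
Local Notation T := (obs R d a0).

Lemma measurable_score (w : d.-tuple R) :
  measurable_fun [set: T] (fun z : T => dot w (feat z)).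
Proof.
rewrite /dot; apply: measurable_sum => l; apply: measurable_funM => //.
apply: (@measurableT_comp _ _ _ _ _ _ (fun x : d.-tuple R => tnth x l)).
  exact: measurable_tnth.
by apply: measurableT_comp => //; exact: measurable_fst.
Qed.

Lemma halfspace_measurable (G : pred T) (wt : d.-tuple R * R) :
  measurable [set z | G z] -> measurable [set z | halfspace G wt z].
Proof.
move=> mG.
rewrite (_ : [set _ | _] = [set z | G z] `&`
  ((fun z : T => dot wt.1 (feat z)) @^-1` `]wt.2, +oo[)).
  apply: measurableI => //; rewrite -[X in measurable X]setTI.
  exact: measurable_score.
apply/seteqP; split => z /=; rewrite /halfspace in_itv/= andbT.
  by move/andP.
by move=> [-> ->].
Qed.

Variables (dO : measure_display) (Om : measurableType dO).
Variables (P : probability T R) (Pr : probability Om R) (n : nat).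
Variable Z : 'I_n -> {RV Pr >-> T}.

Lemma halfspace_deviation (G : pred T) (q L : R) :
  iid_sample P Z -> measurable [set z | G z] ->
  0 < q -> mass P G <= q -> (0 < n)%N -> 1 <= L ->
  exists E : set Om, [/\ measurable E,
    ((1 - (4 * (n%:R * q)^-1 + expR (- L) / 4))%:E <= Pr E)%E &
    forall om, E om -> forall wt,
      `|hits Z (halfspace G wt) om - n%:R * mass P (halfspace G wt)| <=
      48 * Num.sqrt (10 * (4 * (n%:R * q) * (d.+1%:R + L)))].
Proof.
move=> iidZ mG q0 Gq n0 L1.
pose rat_pt (v : d.-tuple rat * rat) : d.-tuple R * R :=
  ([tuple ratr (tnth v.1 l) | l < d], ratr v.2).
(* Enumerates the rational half-spaces; codes of nothing are sent to a default one. *)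
pose C k := halfspace G (rat_pt (odflt ([tuple 0 | _ < d], 0) (unpickle k))).
have mC k : measurable [set z | C k z] by exact: halfspace_measurable.
have vcC : vc_class C d.+1.
  by move=> h; have [b bP] := halfspace_vc G h; exists b => k; exact: bP.
have Cq : (P (\bigcup_k [set z | C k z]) <= q%:E)%E.
  apply: (@le_trans _ _ (P [set z | G z])); last by rewrite mass_fin// lee_fin.
  apply: le_measure; rewrite ?inE//; first exact: bigcup_measurable.
  by move=> z [k _ /andP[]].
have [] := vc_inequality iidZ mC vcC q0 Cq n0 L1.
set dev := 48 * _; set bad := \bigcup_k _ => mbad Prbad.
exists (~` bad); split; first exact: measurableC.
  by rewrite probability_setC// EFinB leeB.
move=> om badN wt; have devC k :
    `|hits Z (C k) om - n%:R * mass P (C k)| <= dev.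
  by rewrite leNgt; apply/negP => Ck; apply: badN; exists k.
apply/ler_addgt0Pr => eta eta0.
have [u uP] := halfspace_rat_approx G wt.1 wt.2.
rewrite -surjective_pairing in uP.
have n0R : 0 < n%:R :> R by rewrite ltr0n.
have eta0n : 0 < eta / n%:R by rewrite divr_gt0.
have [N NP] := mass_stable P (fun m => halfspace_measurable (rat_pt (u m)) mG)
  (halfspace_measurable wt mG) uP eta0n.
have [f fP] := choice (fun i : 'I_n => uP (Z i om)).
(* At this index the rational half-space contains exactly the same sample points, and its mass is
   within eta / n of the limit. *)
pose m := (N + \max_i f i)%N.
have hitsE : hits Z (halfspace G (rat_pt (u m))) om = hits Z (halfspace G wt) om.
  apply: eq_bigr => i _; rewrite fP//.
  by apply: leq_trans (leq_addl _ _); exact: leq_bigmax.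
have := devC (pickle (u m)); rewrite /C pickleK/= hitsE.
have := NP m (leq_addr _ _).
set a := mass P _; set b := mass P _ => ab.
have {}ab : `|n%:R * a - n%:R * b| <= eta.
  by rewrite -mulrBr normrM gtr0_norm// mulrC -ler_pdivlMr.
move: ab; rewrite !ler_distl; lra.
Qed.

End halfspace_deviation.

(** * Pairwise demographic parity *)

Section threshold_levels.
Variables (R : realType) (d k : nat) (th : k.-1.-tuple R).
Hypotheses (k2 : (2 <= k)%N) (sth : sorted <=%R th).
Variable s : d.-tuple R -> R.
Implicit Type x : d.-tuple R.

(** The predicted label is the least i >= 1 with s x <= theta_i, which exists because theta_k = +oo.
    Events about labels thereby become half-spaces. *)
Lemma threshold_model_level x : (1 <= threshold_model s th x <= k)%N /\
  forall j, (1 <= j < k)%N ->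
    (j < threshold_model s th x)%N = (nth 0 th j.-1 < s x).
Proof.
pose Q i := (0 < i)%N && ((s x)%:E <= threshold th i)%E.
have Qk : Q k.
  rewrite /Q /threshold ltnn; have k0 : (0 < k)%N by exact: ltn_trans k2.
  by rewrite k0 gtn_eqF// leey.
have exQ : exists i, Q i by exists k.
have [i /andP[i0 si] imin] := ex_minnP exQ.
have ik : (i <= k)%N by exact: imin.
have gti j : (1 <= j)%N -> (j < i)%N -> (threshold th j < (s x)%:E)%E.
  move=> j1 ji; rewrite ltNge; apply/negP => sj.
  by have := imin j; rewrite /Q j1 sj => /(_ isT); rewrite leqNgt ji.
have thj j : (1 <= j < k)%N -> threshold th j = (nth 0 th j.-1)%:E.
  by move=> /andP[j1 jk]; rewrite /threshold gtn_eqF// jk.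
have -> : threshold_model s th x = i.
  apply/threshold_modelP => //; first by rewrite i0.
  rewrite si andbT; case: i i0 {si imin ik} gti => // -[|i] _ gti.
    by rewrite /threshold/= ltNyr.
  by apply: gti.
split; first by rewrite i0.
move=> j jk; rewrite -lte_fin -thj//; have /andP[j1 _] := jk.
have [ji|ij] := ltnP j i; first by rewrite gti.
apply/esym/negbTE; rewrite -leNgt (le_trans si)//.
exact: threshold_homo.
Qed.

End threshold_levels.

Section finite_events.
Variables (R : realType) (dO : measure_display) (Om : measurableType dO).
Variable Pr : probability Om R.

(** A union bound for events that are only known to exist: each S i survives shrinking, so the
    events may be intersected. *)
Lemma finite_events (I : finType) (e : I -> R) (S : I -> set Om -> Prop) :
  (forall i, exists E, [/\ measurable E, ((1 - e i)%:E <= Pr E)%E & S i E]) ->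
  (forall i E F, S i E -> F `<=` E -> S i F) ->
  exists E, [/\ measurable E, ((1 - \sum_i e i)%:E <= Pr E)%E & forall i, S i E].
Proof.
move=> exE Smono.
suff [E [mE PrE SE]] : exists E, [/\ measurable E,
    ((1 - \sum_(i <- enum I) e i)%:E <= Pr E)%E &
    forall i, i \in enum I -> S i E].
  exists E; split => // [|i]; first by move: PrE; rewrite big_enum.
  by apply: SE; rewrite mem_enum.
elim: (enum I) => [|i r [E [mE PrE SE]]].
  by exists setT; split => //; rewrite big_nil subr0 probability_setT.
have [F [mF PrF SF]] := exE i.
exists (F `&` E); split; first exact: measurableI.
  rewrite big_cons; have mFE := measurableI _ _ mF mE.
  have : (Pr (~` (F `&` E)) <= Pr (~` F) + Pr (~` E))%E.
    by rewrite setCI; apply: measureU2; exact: measurableC.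
  rewrite !probability_setC//.
  move: PrF PrE; rewrite -(fineK (fin_num_measure Pr _ mFE)).
  rewrite -(fineK (fin_num_measure Pr _ mF)) -(fineK (fin_num_measure Pr _ mE)).
  by rewrite -!EFinB -!EFinD !lee_fin; lra.
move=> j; rewrite inE => /orP[/eqP ->|/SE].
  by apply: Smono SF _ => x [].
by move=> SjE; apply: Smono SjE _ => x [].
Qed.

End finite_events.

(** * Order probabilities of two independent draws *)

Section pair_product.
Variables (R : realType) (d : nat) (A : finType) (a0 : A).
Local Notation T := (obs R d a0).

(** The common property of [pair_law P] and [pair_freq D], which lets the order probabilities be
    computed once for both. The indicator identity says that E is the disjoint union of the
    rectangles e1 j x e2 j. The diagonal pairs counted by [pair_freq] make it an exact product. *)
Definition product_like (Q : set (T * T) -> R) (m : pred T -> R) :=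
  forall (N : nat) (e1 e2 : 'I_N -> pred T) (E : set (T * T)),
  (forall j, measurable [set z | e1 j z]) ->
  (forall j, measurable [set z | e2 j z]) ->
  (forall z, \1_E z = \sum_j (e1 j z.1 && e2 j z.2)%:R :> R) ->
  Q E = \sum_j m (e1 j) * m (e2 j).

Lemma pair_freq_product n (D : n.-tuple T) :
  product_like (pair_freq D)
    (fun a => (\sum_(i < n) (a (tnth D i))%:R) / n%:R).
Proof.
move=> N e1 e2 E _ _ EE; rewrite /pair_freq.
transitivity ((\sum_(j < N) (\sum_(i < n) (e1 j (tnth D i))%:R) *
    (\sum_(i < n) (e2 j (tnth D i))%:R)) / n%:R ^+ 2 : R).
  congr (_ / _); under eq_bigr => i _ do under eq_bigr => i' _ do rewrite EE/=.
  under eq_bigr => i _ do rewrite exchange_big/=.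
  rewrite exchange_big/=; apply: eq_bigr => j _.
  rewrite mulr_suml; apply: eq_bigr => i _; rewrite mulr_sumr.
  by apply: eq_bigr => i' _; rewrite -natrM mulnb.
rewrite mulr_suml; apply: eq_bigr => j _.
by rewrite expr2 invfM mulrACA.
Qed.

Lemma pair_law_product (P : probability T R) :
  product_like (pair_law P) (mass P).
Proof.
move=> N e1 e2 E m1 m2 EE; rewrite /pair_law.
pose r j := [set z | e1 j z] `*` [set z | e2 j z].
have rE j z : r j z <-> e1 j z.1 && e2 j z.2.
  by split => [[/= -> ->]|/andP[]].
have mr j : measurable (r j) by exact: measurableX.
have -> : E = \big[setU/set0]_(j < N) r j.
  apply/seteqP; split => z.
    move=> Ez; have := EE z; rewrite indicE mem_set// => sum1.
    rewrite -bigcup_seq; have [j rj] : exists j, r j z.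
      apply/not_existsP => nr; move: sum1; rewrite big1 => [/eqP|j _].
        by rewrite oner_eq0.
      by case: (boolP (_ && _)) => // /rE /nr.
    by exists j => //=; rewrite mem_index_enum.
  rewrite -bigcup_seq => -[j _ /rE rj]; apply: contrapT => nEz.
  have := EE z; rewrite indicE memNset// => /esym/eqP.
  rewrite psumr_eq0// => /allP/(_ j (mem_index_enum _)).
  by rewrite rj oner_eq0.
rewrite measure_bigsetU_ord//.
  rewrite -[RHS]/(fine (\sum_(j < N) mass P (e1 j) * mass P (e2 j))%:E).
  congr fine; rewrite -sumEFin; apply: eq_bigr => j _.
  by rewrite EFinM -!mass_fin//; exact: product_measure1E.
move=> i j _ _ [z [/rE ri /rE rj]]; apply/eqP/negP => /negP ij.
have := EE z; rewrite (bigD1 i)//= (bigD1 j) 1?eq_sym//= ri rj indicE.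
set S := \sum_(_ < _ | _) _; have S0 : 0 <= S by exact: sumr_ge0.
by case: (z \in E) => /=; lra.
Qed.

Variables (Q : set (T * T) -> R) (m : pred T -> R).
Hypothesis Qm : product_like Q m.
Hypothesis madd : forall a b c : pred T, measurable [set z | a z] ->
  measurable [set z | b z] -> (forall z, a z = b z || c z) ->
  (forall z, ~~ (b z && c z)) -> m c = m a - m b.

Definition level_freq (f : d.-tuple R -> nat) (a : A) (j : nat) : R :=
  m (fun z : T => (attr z == a) && (j < f (feat z))%N) /
  m (fun z : T => attr z == a).

Variables (f : d.-tuple R -> nat) (k : nat).
Hypothesis fk : forall x, (1 <= f x <= k)%N.
Hypothesis mf : forall a j,
  measurable [set z : T | (attr z == a) && (j < f (feat z))%N].

Let mattr a : measurable [set z : T | attr z == a].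
Proof.
rewrite (_ : [set _ | _] = [set z : T | (attr z == a) && (0 < f (feat z))%N])//.
by apply: eq_set => z; have /andP[-> _] := fk (feat z); rewrite andbT.
Qed.

Let eq_level a j (z : T) : (attr z == a) && (f (feat z) == j.+1) =
  ((attr z == a) && (j < f (feat z))%N) && ~~ ((attr z == a) && (j.+1 < f (feat z))%N).
Proof. by case: (attr z == a) => //=; rewrite -leqNgt eqn_leq andbC. Qed.

Let meq a j : measurable [set z : T | (attr z == a) && (f (feat z) == j.+1)].
Proof.
rewrite (_ : [set _ | _] = [set z : T | (attr z == a) && (j < f (feat z))%N]
   `\` [set z : T | (attr z == a) && (j.+1 < f (feat z))%N]).
  exact: measurableD.
apply/seteqP; split => z /=; rewrite eq_level; first by move=> /andP[? /negP].
by move=> [? /negP ?]; apply/andP.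
Qed.

Let m_eq a j : m (fun z : T => (attr z == a) && (f (feat z) == j.+1)) /
    m (fun z : T => attr z == a) = level_freq f a j - level_freq f a j.+1.
Proof.
rewrite /level_freq -mulrBl; congr (_ / _); apply: madd => // z.
  by case: (attr z == a) => //=; apply/idP/idP; lia.
by case: (attr z == a) => //=; apply/negP; lia.
Qed.

Let Q_group a b : Q [set z : T * T | attr z.1 = a /\ attr z.2 = b] =
  m (fun z : T => attr z == a) * m (fun z : T => attr z == b).
Proof.
rewrite (@Qm 1 (fun _ (z : T) => attr z == a) (fun _ (z : T) => attr z == b)) ?big_ord1//.
move=> z; rewrite big_ord1 indicE; congr (_%:R); congr nat_of_bool.
by apply/idP/andP => [/set_mem[-> ->]|[/eqP ? /eqP ?]]; rewrite ?inE.
Qed.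

(** Split by the value j + 1 of f at the second point. The value k is impossible there because f <=
    k at the first point, hence k - 1 terms. *)
Lemma cond_pr_gt a b :
  cond_pr Q [set z : T * T | (f (feat z.1) > f (feat z.2))%N]
    [set z : T * T | attr z.1 = a /\ attr z.2 = b] =
  \sum_(j < k.-1) level_freq f a j.+1 *
    (level_freq f b j - level_freq f b j.+1).
Proof.
rewrite /cond_pr Q_group.
rewrite (@Qm k.-1 (fun j (z : T) => (attr z == a) && (j.+1 < f (feat z))%N)
  (fun j (z : T) => (attr z == b) && (f (feat z) == j.+1)))//; last first.
  move=> z; rewrite indicE.
  have [/set_mem[/= fz [az bz]]|zE] := boolP (z \in _).
    have /andP[f1 fk1] := fk (feat z.1); have /andP[f2 _] := fk (feat z.2).
    have ltk : ((f (feat z.2)).-1 < k.-1)%N by rewrite -!subn1; lia.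
    rewrite (bigD1 (Ordinal ltk))//= az bz !eqxx prednK// fz eqxx big1 ?addr0//.
    move=> j; rewrite -val_eqE/= => jf.
    by case: eqP => [fj|]; rewrite ?andbF//; move: jf; rewrite fj eqxx.
  rewrite big1// => j _; case: (boolP (_ && _)) => // /andP[/andP[/eqP az fz] /andP[/eqP bz /eqP fj]].
  by move/negP: zE; case; rewrite inE/=; split => //=; rewrite fj.
rewrite mulr_suml; apply: eq_bigr => j _.
by rewrite invfM mulrACA m_eq.
Qed.

Lemma cond_pr_lt a b :
  cond_pr Q [set z : T * T | (f (feat z.1) < f (feat z.2))%N]
    [set z : T * T | attr z.1 = a /\ attr z.2 = b] =
  \sum_(j < k.-1) level_freq f b j.+1 *
    (level_freq f a j - level_freq f a j.+1).
Proof.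
rewrite /cond_pr Q_group.
rewrite (@Qm k.-1 (fun j (z : T) => (attr z == a) && (f (feat z) == j.+1))
  (fun j (z : T) => (attr z == b) && (j.+1 < f (feat z))%N))//; last first.
  move=> z; rewrite indicE.
  have [/set_mem[/= fz [az bz]]|zE] := boolP (z \in _).
    have /andP[f1 _] := fk (feat z.1); have /andP[f2 fk2] := fk (feat z.2).
    have ltk : ((f (feat z.1)).-1 < k.-1)%N by rewrite -!subn1; lia.
    rewrite (bigD1 (Ordinal ltk))//= az bz !eqxx prednK// fz eqxx big1 ?addr0//.
    move=> j; rewrite -val_eqE/= => jf.
    by case: eqP => [fj|]//; move: jf; rewrite fj eqxx.
  rewrite big1// => j _; case: (boolP (_ && _)) => //.
  move=> /andP[/andP[/eqP az /eqP fj] /andP[/eqP bz fz]].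
  by move/negP: zE; case; rewrite inE/=; split => //=; rewrite fj.
rewrite mulr_suml; apply: eq_bigr => j _.
by rewrite invfM mulrACA m_eq mulrC.
Qed.

End pair_product.

(** * From deviations of counts to deviations of conditional frequencies *)

Section deviation_transfer.
Variable R : realType.

Lemma ratio_dist (x y x' y' D : R) : 0 < y -> 0 < y' -> 0 <= x' <= y' ->
  `|x' - x| <= D -> `|y' - y| <= D -> `|x / y - x' / y'| <= 2 * D / y.
Proof.
move=> y0 y'0 /andP[x'0 xy'] xD yD.
have -> : x / y - x' / y' = ((x - x') + x' / y' * (y' - y)) / y.
  by field; rewrite !gt_eqF.
rewrite normrM (gtr0_norm (x := y^-1)) ?invr_gt0// ler_pM2r ?invr_gt0//.
apply: (le_trans (ler_normD _ _)); rewrite mulrDl !mul1r lerD//.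
  by rewrite distrC.
have r0 : 0 <= x' / y' by rewrite divr_ge0// ltW.
rewrite normrM ger0_norm// -[leRHS]mul1r ler_pM//.
by rewrite ler_pdivrMr// mul1r.
Qed.

(** The deviation equals 48 y S with S = sqrt (40 X / y), a relative error. The smallness of X gives
    48 S < 1, so the group is hit by the sample; numerator and denominator each contribute 48 S to
    the ratio, and y >= b bounds S. *)
Lemma group_ratio_close (x y x' y' X b : R) :
  0 < b -> b <= y -> 0 <= X -> 48 ^+ 2 * 40 * X < b -> 0 <= x' <= y' ->
  `|x' - x| <= 48 * Num.sqrt (10 * (4 * y * X)) ->
  `|y' - y| <= 48 * Num.sqrt (10 * (4 * y * X)) ->
  0 < y' /\ `|x / y - x' / y'| <= 96 * Num.sqrt (40 * X / b).
Proof.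
move=> b0 by_ X0 Xb xy'; have y0 : 0 < y by exact: lt_le_trans by_.
have -> : 10 * (4 * y * X) = y ^+ 2 * (40 * X / y) by field; rewrite gt_eqF.
rewrite sqrtrM ?sqr_ge0// sqrtr_sqr (gtr0_norm y0); set S := Num.sqrt (40 * X / y).
have S0 : 0 <= S by exact: sqrtr_ge0.
have Sb : S <= Num.sqrt (40 * X / b).
  by rewrite ler_wsqrtr// ler_wpM2l ?mulr_ge0// lef_pV2.
have S1 : 48 * S < 1.
  have : (48 * S) ^+ 2 < 1.
    rewrite exprMn sqr_sqrtr ?divr_ge0 ?mulr_ge0 ?(ltW y0)//.
    by rewrite !mulrA ltr_pdivrMr// mul1r (lt_le_trans Xb).
  by rewrite expr_lt1// mulr_ge0.
move=> xD yD; have y'0 : 0 < y'.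
  have yS : 0 < y * (1 - 48 * S) by rewrite mulr_gt0// subr_gt0.
  by move: yD; rewrite ler_distl => /andP[yD _]; lra.
split => //; apply: (le_trans (ratio_dist y0 y'0 xy' xD yD)).
have -> : 2 * (48 * (y * S)) / y = 96 * S by field; rewrite gt_eqF.
by rewrite ler_pM2l.
Qed.

Lemma sum_prod_dist (N : nat) (u u' v v' : nat -> R) (D : R) :
  (forall j, (j <= N)%N -> `|u j - u' j| <= D) ->
  (forall j, (j <= N)%N -> `|v j - v' j| <= D) ->
  (forall j, 0 <= u' j <= 1) -> (forall j, 0 <= v j <= 1) ->
  `|\sum_(j < N) u j.+1 * (v j - v j.+1)
    - \sum_(j < N) u' j.+1 * (v' j - v' j.+1)| <= 3 * N%:R * D.
Proof.
move=> uD vD u'01 v01; rewrite -sumrB; apply: (le_trans (ler_norm_sum _ _ _)).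
apply: (@le_trans _ _ (\sum_(j < N) 3 * D)); last first.
  by rewrite sumr_const card_ord -[leLHS]mulr_natl mulrCA mulrA.
apply: ler_sum => j _.
have := uD _ (ltn_ord j); have := vD _ (ltn_ord j); have := vD _ (ltnW (ltn_ord j)).
have := u'01 j.+1; have := v01 j; have := v01 j.+1.
move: (u j.+1) (u' j.+1) (v j) (v j.+1) (v' j) (v' j.+1) => a a' b c b' c'.
move=> /andP[c0 c1] /andP[b0 b1] /andP[a'0 a'1] bb cc aa.
have -> : a * (b - c) - a' * (b' - c') =
    (a - a') * (b - c) + a' * ((b - b') - (c - c')) by ring.
apply: (le_trans (ler_normD _ _)); rewrite !normrM.
have bc : `|b - c| <= 1 by rewrite ler_distl; lra.
have h1 : `|a - a'| * `|b - c| <= D by rewrite -[leRHS]mulr1 ler_pM.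
have h2 : `|a'| * `|b - b' - (c - c')| <= 1 * (D + D).
  apply: ler_pM => //; first by rewrite ger0_norm.
  by apply: (le_trans (ler_normB _ _)); exact: lerD.
lra.
Qed.

Lemma bigmax_shift (I : finType) (F G : I -> R) (c : R) :
  0 <= c -> (forall i, F i <= G i + c) ->
  \big[Num.max/0]_i F i <= \big[Num.max/0]_i G i + c.
Proof.
move=> c0 FG; apply: bigmax_le => [|i _].
  by rewrite addr_ge0//; apply: bigmax_ge_id.
by apply: (le_trans (FG i)); rewrite lerD2r; apply: le_bigmax.
Qed.

End deviation_transfer.

Section demographic_parity.
Variables (R : realType) (d : nat) (A : finType) (a0 : A).
Local Notation T := (obs R d a0).
Variables (P : probability T R) (n : nat) (D : n.-tuple T).
Variables (f : d.-tuple R -> nat) (k : nat).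
Hypothesis fk : forall x, (1 <= f x <= k)%N.
Hypothesis mf : forall a j,
  measurable [set z : T | (attr z == a) && (j < f (feat z))%N].

Definition emp_mass (a : pred T) : R := (\sum_(i < n) (a (tnth D i))%:R) / n%:R.

Lemma massB (a b c : pred T) : measurable [set z | a z] ->
  measurable [set z | b z] -> (forall z, a z = b z || c z) ->
  (forall z, ~~ (b z && c z)) -> mass P c = mass P a - mass P b.
Proof.
move=> ma mb abc bc.
have cE : [set z | c z] = [set z | a z] `\` [set z | b z].
  apply/seteqP; split => z /=.
    by have := abc z; have := bc z; case: (c z); case: (b z) => //= _ ->.
  by rewrite abc => -[/orP[bz /(_ bz)//|]].
have mc : measurable [set z | c z] by rewrite cE; exact: measurableD.
apply/eqP; rewrite eq_sym subr_eq addrC; apply/eqP/EFin_inj.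
rewrite EFinD -!mass_fin// -measureU//.
  by congr (P _); apply/seteqP; split => z /=; rewrite abc => /orP.
by apply/seteqP; split => // z [/= bz cz]; have := bc z; rewrite bz cz.
Qed.

Lemma emp_massB (a b c : pred T) : measurable [set z | a z] ->
  measurable [set z | b z] -> (forall z, a z = b z || c z) ->
  (forall z, ~~ (b z && c z)) -> emp_mass c = emp_mass a - emp_mass b.
Proof.
move=> _ _ abc bc; rewrite /emp_mass -mulrBl -sumrB; congr (_ / _).
apply: eq_bigr => i _; rewrite abc; have := bc (tnth D i).
by case: (b _); case: (c _) => //= _; rewrite ?subrr ?subr0.
Qed.

Lemma mass_le (a b : pred T) : measurable [set z | a z] ->
  measurable [set z | b z] -> (forall z, a z -> b z) -> mass P a <= mass P b.
Proof.
move=> ma mb ab; rewrite -lee_fin -!mass_fin//; apply: le_measure; rewrite ?inE//.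
Qed.

Let mattr a : measurable [set z : T | attr z == a].
Proof.
rewrite (_ : [set _ | _] = [set z : T | (attr z == a) && (0 < f (feat z))%N])//.
by apply: eq_set => z; have /andP[-> _] := fk (feat z); rewrite andbT.
Qed.

Let ratio01 (x y : R) : 0 <= x <= y -> 0 <= x / y <= 1.
Proof.
move=> /andP[x0 xy]; rewrite divr_ge0 ?(le_trans x0)//=.
have [y0|y0] := ltP 0 y; first by rewrite ler_pdivrMr// mul1r.
have -> : x = 0 by apply/eqP; rewrite eq_le x0 (le_trans xy).
by rewrite mul0r.
Qed.

Let level01_mass a j : 0 <= level_freq (mass P) f a j <= 1.
Proof.
apply: ratio01; rewrite fine_ge0//=.
by apply: (mass_le (mf a j) (mattr a)) => z /andP[].
Qed.

Let level01_emp a j : 0 <= level_freq emp_mass f a j <= 1.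
Proof.
apply: ratio01; rewrite divr_ge0 ?sumr_ge0//= ler_wpM2r ?invr_ge0//.
apply: ler_sum => i _; rewrite ler_nat.
by case: (attr _ == a); case: (_ < _)%N.
Qed.

(** 6 = 2 * 3: a violation is a difference of two conditional probabilities, each of which moves by
    at most 3 (k - 1) del. *)
Lemma DP_viol_le (del : R) : 0 <= del ->
  (forall a j, (j < k)%N ->
    `|level_freq (mass P) f a j - level_freq emp_mass f a j| <= del) ->
  DP_viol f (pair_law P) <= DP_viol f (pair_freq D) + 6 * k.-1%:R * del.
Proof.
move=> del0 levD; rewrite /DP_viol; apply: bigmax_shift => [|[a b]/=].
  by rewrite mulr_ge0// mulr_ge0.
have PL := @pair_law_product R d A a0 P; have PF := pair_freq_product D.
have k0 : (0 < k)%N by have := fk [tuple 0 | _ < d]; lia.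
have kj j : (j <= k.-1)%N -> (j < k)%N by lia.
rewrite !(cond_pr_gt PL massB fk mf) !(cond_pr_lt PL massB fk mf).
rewrite !(cond_pr_gt PF emp_massB fk mf) !(cond_pr_lt PF emp_massB fk mf).
have h a1 b1 := @sum_prod_dist R k.-1 _ _ _ _ del
  (fun j jk => levD a1 j (kj j jk)) (fun j jk => levD b1 j (kj j jk))
  (level01_emp a1) (level01_mass b1).
have tri (x1 x2 x3 x4 c : R) : `|x1 - x3| <= c -> `|x2 - x4| <= c ->
    `|x1 - x2| <= `|x3 - x4| + 2 * c.
  move=> h1 h2; have -> : x1 - x2 = (x3 - x4) + ((x1 - x3) - (x2 - x4)) by ring.
  apply: (le_trans (ler_normD _ _)); rewrite lerD2l.
  by apply: (le_trans (ler_normB _ _)); lra.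
by apply: (le_trans (tri _ _ _ _ _ (h a b) (h b a))); rewrite lerD2l; lra.
Qed.

End demographic_parity.

(** * Mean absolute error *)

Section mean_absolute_error.
Variables (R : realType) (d : nat) (A : finType) (a0 : A).
Local Notation T := (obs R d a0).
Variables (P : probability T R) (f : d.-tuple R -> nat) (k : nat).
Hypothesis fk : forall x, (1 <= f x <= k)%N.
Hypothesis mf : forall j, measurable [set z : T | (j < f (feat z))%N].

Definition level_error (j : nat) : pred T :=
  fun z => (j < label z)%N != (j < f (feat z))%N.

Lemma label_measurable (B : pred nat) : measurable [set z : T | B (label z)].
Proof.
rewrite (_ : [set _ | _] = @label R d A a0 @^-1` [set i | B i])//.
rewrite -[X in measurable X]setTI.
have : measurable_fun setT (@label R d A a0).
  exact: measurableT_comp.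
by apply.
Qed.

Lemma level_error_measurable j : measurable [set z | level_error j z].
Proof.
rewrite (_ : [set _ | _] =
  ([set z : T | (j < label z)%N] `\` [set z : T | (j < f (feat z))%N]) `|`
  ([set z : T | (j < f (feat z))%N] `\` [set z : T | (j < label z)%N])).
  by apply: measurableU; apply: measurableD => //; exact: (label_measurable (fun i => j < i)%N).
apply/seteqP; split => z /=; rewrite /level_error.
  by case: (j < label z)%N; case: (j < f (feat z))%N => //= _; [left|right].
by case: (j < label z)%N; case: (j < f (feat z))%N => //= -[] [].
Qed.

Lemma sum_levels (y : nat) : (1 <= y <= k)%N ->
  \sum_(1 <= j < k) (j < y)%N%:R = y%:R - 1 :> R.
Proof.
move=> /andP[y1 yk]; rewrite -natr_sum.
suff -> : (\sum_(1 <= j < k) (j < y) = (minn y k).-1)%N.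
  by rewrite (minn_idPl yk) -subn1 natrB.
elim: k {yk} => [|m IH]; first by rewrite big_geq// minn0.
case: m IH => [|m] IH; first by rewrite big_geq//; lia.
by rewrite big_nat_recr//= IH; lia.
Qed.

Lemma dist_levels z : (1 <= label z <= k)%N ->
  `|(label z)%:R - (f (feat z))%:R| = \sum_(1 <= j < k) (level_error j z)%:R :> R.
Proof.
move=> lk; set y := label z; set x := f (feat z).
have -> : y%:R - x%:R = \sum_(1 <= j < k) ((j < y)%N%:R - (j < x)%N%:R) :> R.
  by rewrite sumrB (sum_levels lk) (sum_levels (fk _)); ring.
have [xy|yx] := leqP x y.
  rewrite ger0_norm ?sumr_ge0// => [|j _].
    apply: eq_bigr => j _; rewrite /level_error -/x -/y.
    have : (j < x)%N ==> (j < y)%N by apply/implyP; lia.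
    by case: (j < y)%N; case: (j < x)%N => //= _; rewrite ?subrr ?subr0.
  have : (j < x)%N ==> (j < y)%N by apply/implyP; lia.
  by rewrite subr_ge0 ler_nat; case: (j < y)%N; case: (j < x)%N.
rewrite ler0_norm ?sumr_le0// => [|j _].
  rewrite -sumrN; apply: eq_bigr => j _; rewrite /level_error -/x -/y opprB.
  have : (j < y)%N ==> (j < x)%N by apply/implyP; lia.
  by case: (j < y)%N; case: (j < x)%N => //= _; rewrite ?subrr ?subr0.
have : (j < y)%N ==> (j < x)%N by apply/implyP; lia.
by rewrite subr_le0 ler_nat; case: (j < y)%N; case: (j < x)%N.
Qed.

Lemma MAE_le (rad : R) : supported rad k P ->
  (MAE f P <= (\sum_(1 <= j < k) mass P (level_error j))%:E)%E.
Proof.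
move=> supp; rewrite /MAE unlock.
have mlab := label_measurable (fun i => 1 <= i <= k)%N.
(* [dist_levels] requires a label in [k], which holds only almost everywhere. *)
have aelab : {ae P, forall z, setT z -> (1 <= label z <= k)%N}.
  exists (~` [set z : T | (1 <= label z <= k)%N]); split.
  - exact: measurableC.
  - rewrite probability_setC//; suff -> : P [set z : T | (1 <= label z <= k)%N] = 1%E.
      by rewrite subee.
    apply/eqP; rewrite eq_le probability_le1//= -supp; apply: le_measure.
    + rewrite inE (_ : [set _ | _] =
        ((@norm2 R d \o @feat R d A a0) @^-1` `]-oo, rad]) `&`
        [set z : T | (1 <= label z <= k)%N]).
        apply: measurableI => //; rewrite -[X in measurable X]setTI.
        have : measurable_fun setT (@norm2 R d \o @feat R d A a0).
          rewrite (_ : _ \o _ = Num.sqrt \o (fun z : T => dot (feat z) (feat z)))//.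
          apply: measurableT_comp.
            apply: continuous_measurable_fun; exact: sqrt_continuous.
          rewrite /dot; apply: measurable_sum => l.
          have ml : measurable_fun setT (fun z : T => tnth (feat z) l).
            apply: (@measurableT_comp _ _ _ _ _ _ (fun x : d.-tuple R => tnth x l)).
              exact: measurable_tnth.
            by apply: measurableT_comp => //; exact: measurable_fst.
          exact: measurable_funM.
        by apply.
      by apply/seteqP; split => z /=; rewrite in_itv/= => /andP.
    + by rewrite inE.
    + by move=> z /= /andP[].
  - by move=> z /= h lz; apply: h.
have mlabR : measurable_fun setT (fun z : T => (label z)%:R : R).
  move=> _ Y _; rewrite setTI.
  rewrite (_ : _ @^-1` _ = [set z : T | `[< Y ((label z)%:R : R) >]]).
    exact: (label_measurable (fun i => `[< Y (i%:R : R) >])).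
  by apply/seteqP; split => z /=; [move=> ?; apply/asboolP|move/asboolP].
(* Measurability is known for the level sets of f only, so f is rebuilt as 1 plus their
   indicators. *)
have mfR : measurable_fun setT (fun z : T => (f (feat z))%:R : R).
  have -> : (fun z : T => (f (feat z))%:R : R) = (fun z : T =>
      1 + \sum_(1 <= j < k) \1_[set z : T | (j < f (feat z))%N] z).
    apply/funext => z; rewrite -[LHS](subrKC 1) -sum_levels//.
    congr (_ + _); apply: eq_bigr => j _; rewrite indicE.
    by congr (_%:R); congr nat_of_bool; apply/idP/idP; rewrite inE.
  apply: measurable_funD => //; apply: measurable_sum => j.
  exact: measurable_indic.
apply: (@le_trans _ _ (\int[P]_z \sum_(1 <= j < k)
    (\1_[set z | level_error j z] z)%:E)%E).
  apply: ae_ge0_le_integral; first exact: measurableT.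
  - by move=> z _; rewrite lee_fin.
  - apply/measurable_EFinP; apply: measurableT_comp => //.
    exact: measurable_funB.
  - by move=> z _; apply: sume_ge0 => j _; rewrite lee_fin.
  - apply: emeasurable_sum => j; apply/measurable_EFinP.
    apply: measurable_indic; exact: level_error_measurable.
  - case: aelab => N [mN PN sN]; exists N; split => // z nz; apply: sN => lz.
    apply: nz => _; rewrite sumEFin lee_fin dist_levels; last exact: lz.
    by apply: ler_sum => j _; rewrite indicE;
      case: (boolP (level_error j z)) => // h; rewrite mem_set.
rewrite ge0_integral_sum//; last first.
  move=> j; apply/measurable_EFinP; apply: measurable_indic.
  exact: level_error_measurable.
rewrite -sumEFin le_eqVlt; apply/orP; left; apply/eqP.
apply: eq_bigr => j _; rewrite integral_indic ?setIT//; last first.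
  exact: level_error_measurable.
apply: mass_fin; exact: level_error_measurable.
Qed.

End mean_absolute_error.

(** * Levels of a threshold model as half-spaces *)

Section learned_model.
Variables (R : realType) (d : nat) (A : finType) (a0 : A) (k : nat).
Local Notation T := (obs R d a0).
Variables (w : d.-tuple R) (th : k.-1.-tuple R).
Hypotheses (k2 : (2 <= k)%N) (sth : sorted <=%R th).
Let f := threshold_model (dot w) th.

Let fk x : (1 <= f x <= k)%N.
Proof. by have [] := threshold_model_level k2 sth (dot w) x. Qed.

Let flevel x j : (1 <= j < k)%N -> (j < f x)%N = (nth 0 th j.-1 < dot w x).
Proof. by have [_] := threshold_model_level k2 sth (dot w) x; apply. Qed.

Lemma attr_measurable (a : A) : measurable [set z : T | attr z == a].
Proof.
rewrite (_ : [set _ | _] = (snd : T -> discrete a0) @^-1` [set (a : discrete a0)]).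
  rewrite -[X in measurable X]setTI.
  have : measurable_fun setT (snd : T -> discrete a0) by exact: measurable_snd.
  by apply.
by apply/seteqP; split => z /= /eqP.
Qed.

Lemma level_halfspace (G : pred T) (j : nat) : (j < k)%N ->
  exists wt, forall z, G z && (j < f (feat z))%N = halfspace G wt z.
Proof.
move=> jk; have [j0|j0] := posnP j.
  (* Level 0 is the whole group since f >= 1; it is cut out by 0 . x > -1. *)
  exists ([tuple 0 | _ < d], -1) => z; rewrite /halfspace j0 /dot/=.
  rewrite big1 => [|i _]; last by rewrite tnth_mktuple mul0r.
  by have /andP[-> _] := fk (feat z); rewrite oppr_lt0 ltr01.
by exists (w, nth 0 th j.-1) => z; rewrite flevel ?j0.
Qed.

Lemma group_halfspace (G : pred T) :
  exists wt, forall z, G z = halfspace G wt z.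
Proof.
have [|wt wtP] := @level_halfspace G 0; first by exact: ltn_trans k2.
by exists wt => z; rewrite -wtP; have /andP[-> _] := fk (feat z); rewrite andbT.
Qed.

Lemma level_measurable (G : pred T) (j : nat) : measurable [set z | G z] ->
  measurable [set z | G z && (j < f (feat z))%N].
Proof.
move=> mG; have [jk|kj] := ltnP j k.
  have [wt wtP] := level_halfspace G jk.
  rewrite (_ : [set _ | _] = [set z | halfspace G wt z]).
    exact: halfspace_measurable.
  by apply: eq_set => z; rewrite wtP.
rewrite (_ : [set _ | _] = set0)//; apply/seteqP; split => // z /= /andP[_].
by have /andP[_ fz] := fk (feat z); lia.
Qed.

Lemma emp_margin_loss_ge n (D : n.-tuple T) (gamma : R) : 0 < gamma ->
  \sum_(1 <= j < k) emp_mass D (level_error f j)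
  <= emp_margin_loss gamma (dot w) th D.
Proof.
move=> g0; rewrite /emp_margin_loss /emp_mass -mulr_suml exchange_big/=.
rewrite ler_wpM2r ?invr_ge0//; apply: ler_sum => i _; rewrite /margin_loss.
rewrite big_nat_cond [leRHS]big_nat_cond; apply: ler_sum => j /andP[jk _].
rewrite ler_nat /level_error flevel// /margin_sign.
set t := nth 0 th j.-1; case: (j < label _)%N; case: (ltP t) => //= h.
  by rewrite mul1r (le_trans _ (ltW g0))// subr_le0.
by rewrite mulN1r (le_trans _ (ltW g0))// oppr_le0 subr_ge0 ltW.
Qed.

Variables (P : probability T R) (n : nat) (D : n.-tuple T) (eta : R).

(** An error is either a point with y > j and f <= j or one with y <= j and f > j. The second kind
    is a half-space in a label group; the first is a label group minus a half-space. Three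
    half-spaces are involved, each costing eta. *)
Lemma level_error_deviation (j : nat) : (j < k)%N ->
  (forall b wt, let H := halfspace (fun z : T => (j < label z)%N == b) wt in
    `|emp_mass D H - mass P H| <= eta) ->
  mass P (level_error f j) <= emp_mass D (level_error f j) + 3 * eta.
Proof.
move=> jk dev; pose G b : pred T := fun z => (j < label z)%N == b.
pose lvl b : pred T := fun z => G b z && (j < f (feat z))%N.
pose miss : pred T := fun z => G true z && ~~ (j < f (feat z))%N.
have devG b : `|emp_mass D (G b) - mass P (G b)| <= eta.
  have [wt wtP] := group_halfspace (G b); have := dev b wt.
  by have -> : G b = halfspace (G b) wt by apply/funext.
have devL b : `|emp_mass D (lvl b) - mass P (lvl b)| <= eta.
  have [wt wtP] := level_halfspace (G b) jk; have := dev b wt.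
  by have -> : lvl b = halfspace (G b) wt by apply/funext.
have mG b : measurable [set z | G b z].
  exact: (@label_measurable R d A a0 (fun i => (j < i)%N == b)).
have mL b : measurable [set z | lvl b z] by exact: level_measurable.
have GE z : G true z = lvl true z || miss z.
  by rewrite /lvl /miss; case: (G true z); case: (j < f _)%N.
have GD z : ~~ (lvl true z && miss z).
  by rewrite /lvl /miss; case: (G true z); case: (j < f _)%N.
have errE z : level_error f j z = miss z || lvl false z.
  rewrite /level_error /miss /lvl /G.
  by case: (j < label z)%N; case: (j < f _)%N.
have errD z : ~~ (miss z && lvl false z).
  rewrite /miss /lvl /G.
  by case: (j < label z)%N; case: (j < f _)%N.
have mE : measurable [set z : T | level_error f j z].
  apply: level_error_measurable => i.
  have mT : measurable [set z : T | predT z].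
    by rewrite (_ : [set _ | _] = setT)//; apply/seteqP; split.
  exact: (level_measurable i mT).
have mM : measurable [set z | miss z].
  rewrite (_ : [set _ | _] = [set z | G true z] `\` [set z | lvl true z]).
    exact: measurableD.
  apply/seteqP; split => z /=; rewrite /miss /lvl.
    by case: (G true z); case: (j < f _)%N.
  by move=> []; case: (G true z); case: (j < f _)%N => //= _ [].
have eM := massB P (mG true) (mL true) GE GD.
have eM' := emp_massB D (mG true) (mL true) GE GD.
have eE := massB P mE mM errE errD.
have eE' := emp_massB D mE mM errE errD.
have := devG true; have := devL true; have := devL false.
rewrite !ler_distl => /andP[h1 h2] /andP[h3 h4] /andP[h5 h6].
by lra.
Qed.

End learned_model.

(** * The learned model *)

Section sample_event.
Variables (R : realType) (d k n : nat) (A : finType) (a0 : A).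
Local Notation T := (obs R d a0).
Variables (P : probability T R) (dO : measure_display) (Om : measurableType dO).
Variables (Pr : probability Om R) (Z : 'I_n -> {RV Pr >-> T}).
Variables (beta delta : R).
Hypotheses (iidZ : iid_sample P Z) (k0 : (0 < k)%N).
Hypotheses (beta0 : 0 < beta) (delta01 : 0 < delta < 1).
Hypothesis massA : forall a : A, beta <= mass P (fun z : T => attr z == a).
Hypotheses (nA : 16 * #|A|%:R / (delta * beta) < n%:R)
  (nk : 32 * k%:R / delta < n%:R).

Local Notation LA := (ln (4 * #|A|%:R / delta)).
Local Notation Lk := (1 + 8 * k%:R / delta).

Let delta0 : 0 < delta. Proof. by case/andP: delta01. Qed.

Let k0R : 0 < k%:R :> R. Proof. by rewrite ltr0n. Qed.

Lemma card_attr_gt0 : 0 < #|A|%:R :> R.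
Proof. by rewrite ltr0n; apply/card_gt0P; exists a0. Qed.

Let n0R : 0 < n%:R :> R.
Proof. by apply: lt_trans nk; rewrite divr_gt0// mulr_gt0. Qed.

Let n0 : (0 < n)%N. Proof. by rewrite -(ltr0n R). Qed.

Lemma lnA_ge1 : 1 <= LA.
Proof.
have A1 : 1 <= #|A|%:R :> R by rewrite ler1n -(ltr0n R) card_attr_gt0.
have AD : 4 <= 4 * #|A|%:R / delta.
  by rewrite ler_pdivlMr//; have /andP[_ d1] := delta01; nra.
rewrite -ler_expR lnK ?posrE; last by apply: lt_le_trans AD.
apply: le_trans AD; have e2 := expR_half_le2 R.
have -> : expR 1 = expR (1 / 2) * expR (1 / 2) :> R.
  by rewrite -expRD; congr expR; lra.
have -> : 4 = 2 * 2 :> R by lra.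
by rewrite ler_pM// expR_ge0.
Qed.

(** Attribute groups enter with q their true mass, label groups with q = 1. The lower bounds on n
    make the 1 / (n q) terms of each family at most delta / 4, and [LA], [Lk] make the exponential
    terms at most delta / 16, for a total of 5 delta / 8. [Lk] is linear in k / delta because only
    its independence of n matters and 1 + x <= e^x then suffices. *)
Lemma sample_event : exists E : set Om,
  [/\ measurable E, ((1 - delta)%:E <= Pr E)%E & forall om, E om ->
   (forall a wt, let G := fun z : T => attr z == a in
      `|hits Z (halfspace G wt) om - n%:R * mass P (halfspace G wt)| <=
      48 * Num.sqrt (10 * (4 * (n%:R * mass P G) * (d.+1%:R + LA)))) /\
   (forall j b wt, (j < k)%N -> let G := fun z : T => (j < label z)%N == b in
      `|hits Z (halfspace G wt) om - n%:R * mass P (halfspace G wt)| <=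
      48 * Num.sqrt (10 * (4 * (n%:R * 1) * (d.+1%:R + Lk))))].
Proof.
pose G (i : A + 'I_k * bool) : pred T := match i with
  | inl a => fun z => attr z == a
  | inr jb => fun z => (jb.1 < label z)%N == jb.2
  end.
pose q (i : A + 'I_k * bool) : R := if i is inl a then mass P (G (inl a)) else 1.
pose L (i : A + 'I_k * bool) : R := if i is inl a then LA else Lk.
pose e i := 4 * (n%:R * q i)^-1 + expR (- L i) / 4.
have q0 i : 0 < q i.
  by case: i => [a|jb] //=; apply: lt_le_trans (massA a).
have mG i : measurable [set z | G i z].
  case: i => [a|[j b]] /=; first exact: attr_measurable.
  exact: (@label_measurable R d A a0 (fun i => (j < i)%N == b)).
have Gq i : mass P (G i) <= q i.
  case: i => // jb; rewrite -lee_fin -(mass_fin P (mG (inr jb))).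
  exact: probability_le1 (mG (inr jb)).
have L1 i : 1 <= L i.
  case: i => [a|jb] /=; first exact: lnA_ge1.
  by rewrite lerDl divr_ge0 ?mulr_ge0// ltW.
have [|E [mE PrE SE]] := @finite_events R dO Om Pr _ e (fun i E => forall om, E om ->
    forall wt, `|hits Z (halfspace (G i) wt) om - n%:R * mass P (halfspace (G i) wt)| <=
      48 * Num.sqrt (10 * (4 * (n%:R * q i) * (d.+1%:R + L i))))
    (fun i => halfspace_deviation iidZ (mG i) (q0 i) (Gq i) n0 (L1 i)).
  by move=> i E F SE FE om Fom; apply: SE; exact: FE.
exists E; split => //; last first.
  move=> om Eom; split => [a wt|j b wt jk]; first exact: (SE (inl a)).
  exact: (SE (inr (Ordinal jk, b))).
apply: le_trans PrE; rewrite lee_fin lerD2l lerN2 big_sumType/=.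
have A0 := card_attr_gt0.
have sumA : \sum_(a : A) e (inl a) <= delta / 4 + delta / 16.
  apply: (@le_trans _ _ (\sum_(a : A) (4 * (n%:R * beta)^-1 +
      delta / (4 * #|A|%:R) / 4))).
    apply: ler_sum => a _; have qa : 0 < n%:R * q (inl a) by rewrite mulr_gt0.
    rewrite /e lerD//.
      by rewrite ler_pM2l// lef_pV2 ?posrE ?mulr_gt0// ler_pM2l// massA.
    rewrite ler_pM2r// expRN lnK; first by rewrite invf_div.
    by rewrite posrE divr_gt0// mulr_gt0.
  rewrite sumr_const -[leLHS]mulr_natl mulrDr; apply: lerD; last first.
    by rewrite le_eqVlt; apply/orP; left; apply/eqP; field; rewrite gt_eqF.
  rewrite mulrA ler_pdivrMr ?mulr_gt0//.
  by move: nA; rewrite ltr_pdivrMr ?mulr_gt0//; lra.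
have sumk : \sum_(jb : 'I_k * bool) e (inr jb) <= delta / 4 + delta / 16.
  rewrite /e/= sumr_const card_prod card_ord card_bool mulr1.
  rewrite -[leLHS]mulr_natl natrM mulrDr; apply: lerD.
    rewrite mulrA ler_pdivrMr//.
    by move: nk; rewrite ltr_pdivrMr//; lra.
  have h : expR (- Lk) <= delta / (8 * k%:R).
    rewrite expRN -[leRHS]invf_div lef_pV2 ?posrE ?expR_gt0 ?divr_gt0 ?mulr_gt0//.
    by apply: le_trans (expR_ge1Dx _); lra.
  apply: (@le_trans _ _ (k%:R * 2 * (delta / (8 * k%:R) / 4))).
    by rewrite ler_pM2l ?mulr_gt0// ler_pM2r.
  by rewrite le_eqVlt; apply/orP; left; apply/eqP; field; rewrite gt_eqF.
by apply: (le_trans (lerD sumA sumk)); have := delta0; lra.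
Qed.

End sample_event.

(** * Comparison with the stated rates *)

Section rates.
Variable R : realType.

(** After cancelling 1 / n under the roots the claim reads 144^2 * 40 C <= M (c ln n + c'), with 144
    = 3 * 48, which is the assumption on ln n. The constant c' may be negative. *)
Lemma margin_rate (n : nat) (C M c c' : R) : (0 < n)%N -> 0 < M -> 0 < c ->
  0 <= C -> (144 ^+ 2 * 40 * C - M * c') / (M * c) <= ln n%:R ->
  3 * (48 * Num.sqrt (10 * (4 * (n%:R * 1) * C)) / n%:R) <=
  Num.sqrt (M / n%:R * (c * ln n%:R + c')).
Proof.
move=> n0 M0 c0 C0; rewrite ler_pdivrMr ?mulr_gt0// => nC.
have n0R : 0 < n%:R :> R by rewrite ltr0n.
have -> : 10 * (4 * (n%:R * 1) * C) = n%:R ^+ 2 * (40 * C / n%:R).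
  by field; rewrite gt_eqF.
rewrite sqrtrM ?sqr_ge0// sqrtr_sqr (gtr0_norm n0R).
set S := Num.sqrt (40 * C / n%:R).
have -> : 3 * (48 * (n%:R * S) / n%:R) = 144 * S.
  by field; rewrite gt_eqF.
rewrite -[144](@ger0_norm R)// -sqrtr_sqr /S -sqrtrM ?sqr_ge0//.
apply: ler_wsqrtr; rewrite !mulrA [leRHS]mulrAC ler_pM2r ?invr_gt0//.
by move: nC; lra.
Qed.

(** The 9 comes from 40 (d + 1 + L) <= 81 (d + L), valid as L >= 1; the factor 1 - r <= 1 only
    enlarges the right-hand side. *)
Lemma parity_rate (n k : nat) (d L beta r : R) : (0 < k)%N -> 0 < n%:R * beta ->
  0 <= d -> 1 <= L -> 0 <= r < 1 ->
  6 * k.-1%:R * (96 * Num.sqrt (40 * (d + 1 + L) / (n%:R * beta))) <=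
  6 * (96 * 9) * k%:R ^+ 2 *
    Num.sqrt ((d + L) * ((1 - r) * n%:R * beta)^-1).
Proof.
move=> k0 nb d0 L1 /andP[r0 r1].
have k1 : 1 <= k%:R :> R by rewrite ler1n.
have kk : k.-1%:R <= k%:R ^+ 2 :> R.
  by rewrite -natrX ler_nat; case: k {k0 k1} => //= k; nia.
have S1 : Num.sqrt (40 * (d + 1 + L) / (n%:R * beta)) <=
    9 * Num.sqrt ((d + L) * ((1 - r) * n%:R * beta)^-1).
  rewrite -[9](@ger0_norm R)// -sqrtr_sqr -sqrtrM ?sqr_ge0//.
  apply: ler_wsqrtr; rewrite mulrA; apply: ler_pM.
  - by rewrite mulr_ge0//; lra.
  - by rewrite invr_ge0 ltW.
  - by lra.
  - rewrite lef_pV2 ?posrE//; last by rewrite -mulrA mulr_gt0// subr_gt0.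
    by rewrite -[leRHS]mul1r -mulrA ler_pM2r//; lra.
set S := Num.sqrt _ in S1 *; set S' := Num.sqrt _ in S1 *.
have S0 : 0 <= S by exact: sqrtr_ge0.
apply: (@le_trans _ _ (6 * k%:R ^+ 2 * (96 * (9 * S')))).
  by apply: ler_pM; rewrite ?mulr_ge0// ler_pM2l.
by rewrite le_eqVlt; apply/orP; left; apply/eqP; ring.
Qed.

End rates.

Local Open Scope ring_scope.

Theorem theorem1 (R : realType) :
  exists M : R,
  forall (rad nu : R) (k d m : nat) (beta gamma delta : R),
    0 < rad -> 0 < nu -> (2 <= k)%N -> (1 <= d)%N ->
    0 < beta -> 0 < gamma -> 0 < delta < 1 ->
  exists n0 : nat,
  forall (A : finType) (a0 : A) (P : probability (obs R d a0) R),
    #|A| = m ->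
    supported rad k P ->
    (forall a : A, (beta%:E <= P [set z | attr z = a])%E) ->
  forall n : nat, (n0 <= n)%N ->
  forall (st : strategy R d a0 k n)
         (dO : measure_display) (Om : measurableType dO)
         (Pr : probability Om R) (Z : 'I_n -> {RV Pr >-> obs R d a0}),
    iid_sample P Z ->
  exists E : set Om,
    [/\ measurable E, ((1 - delta)%:E <= Pr E)%E &
      forall om : Om, E om ->
      forall (w : d.-tuple R) (th : k.-1.-tuple R),
        two_step st rad nu (dataset Z om) w th ->
        (MAE (threshold_model (dot w) th) P <=
          (emp_margin_loss gamma (dot w) th (dataset Z om)
           + (k%:R - 1) *
             Num.sqrt (M / n%:R *
               (rad ^+ 2 * nu / gamma ^+ 2 * ln n%:R
                + ln (2 * ((k%:R - 1) * rad * Num.sqrt nu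
                           / (gamma * delta)))))) %:E)%E /\
        DP_viol (threshold_model (dot w) th) (pair_law P) <=
          DP_viol (threshold_model (dot w) th) (pair_freq (dataset Z om))
          + M * k%:R ^+ 2 *
            Num.sqrt ((d%:R + ln (4 * #|A|%:R / delta)) *
              ((1 - Num.sqrt (2 * ln (4 * #|A|%:R / delta) / (n%:R * beta)))
               * n%:R * beta)^-1)].
Proof.
(* The value is imposed by [parity_rate]; in the bound on the mean absolute error any positive M can
   be compensated by n0. *)
pose M : R := 6 * (96 * 9); have M0 : 0 < M by rewrite !mulr_gt0.
exists M => rad nu k d m beta gamma delta rad0 nu0 k2 d1 beta0 gamma0 delta01.
have /andP[delta0 delta1] := delta01.
have k0 : (0 < k)%N by exact: ltnW.
pose c := rad ^+ 2 * nu / gamma ^+ 2.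
pose c' := ln (2 * ((k%:R - 1) * rad * Num.sqrt nu / (gamma * delta))).
have c0 : 0 < c by rewrite divr_gt0 ?mulr_gt0 ?exprn_gt0.
pose L : R := ln (4 * m%:R / delta); pose L' : R := 1 + 8 * k%:R / delta.
pose K := (144 ^+ 2 * 40 * (d.+1%:R + L') - M * c') / (M * c).
pose X1 := 48 ^+ 2 * 40 * (d.+1%:R + L) / beta.
pose X2 := 16 * m%:R / (delta * beta).
pose X3 := 32 * k%:R / delta.
(* X1 makes every group visible in the sample with relative error below 1, X2 and X3 serve the
   failure probability in [sample_event], and expR K yields K <= ln n for [margin_rate]. *)
exists (Num.truncn (X1 + X2 + X3 + expR K)).+1.
move=> A a0 P cardA supp Pbeta n n0n st dO Om Pr Z iidZ.
have L1 : 1 <= L by rewrite /L -cardA; apply: lnA_ge1.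
have massA a : beta <= mass P (fun z : obs R d a0 => attr z == a).
  rewrite -lee_fin -mass_fin; last exact: attr_measurable.
  by rewrite (_ : [set _ | _] = [set z | attr z = a])//; apply/seteqP; split => z /= /eqP.
have X10 : 0 <= X1.
  by rewrite divr_ge0 ?(ltW beta0)// !mulr_ge0// addr_ge0// (le_trans _ L1).
have X20 : 0 <= X2.
  by rewrite divr_ge0 ?mulr_ge0// ltW.
have X30 : 0 <= X3 by rewrite divr_ge0 ?mulr_ge0// ltW.
have K0 := expR_gt0 K.
have nX : X1 + X2 + X3 + expR K < n%:R.
  by apply: lt_le_trans (truncnS_gt _) _; rewrite ler_nat.
have n0R : 0 < n%:R :> R by lra.
have n0 : (0 < n)%N by rewrite -(ltr0n R).
have nb : 0 < n%:R * beta by exact: mulr_gt0.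
have nX1 : 48 ^+ 2 * 40 * (d.+1%:R + L) < n%:R * beta.
  by rewrite -ltr_pdivrMr// -/X1; lra.
have lnK' : K <= ln n%:R.
  by rewrite -ler_expR lnK ?posrE//; lra.
have := sample_event iidZ k0 beta0 delta01 massA.
rewrite cardA => /(_ _ _)[||E [mE PrE SE]]; [by rewrite -/X2; lra|by rewrite -/X3; lra|].
exists E; split => // om /SE[devA devk] w th [_ [[sth _] _]].
set f := threshold_model (dot w) th.
have fk x : (1 <= f x <= k)%N by have [] := threshold_model_level k2 sth (dot w) x.
have emp_hits a : emp_mass (dataset Z om) a = hits Z a om / n%:R.
  by congr (_ / _); apply: eq_bigr => i _; rewrite tnth_mktuple.
split.
- have mf j : measurable [set z : obs R d a0 | (j < f (feat z))%N].
    have mT : measurable [set z : obs R d a0 | predT z].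
      by rewrite (_ : [set _ | _] = setT)//; apply/seteqP; split.
    exact: (level_measurable w k2 sth j mT).
  apply: (le_trans (MAE_le fk mf supp)); rewrite lee_fin.
  pose eta := 48 * Num.sqrt (10 * (4 * (n%:R * 1) * (d.+1%:R + L'))) / n%:R.
  have rate : 3 * eta <= Num.sqrt (M / n%:R * (c * ln n%:R + c')).
    apply: margin_rate => //; rewrite addr_ge0// addr_ge0// divr_ge0 ?mulr_ge0//.
    exact: ltW.
  apply: (@le_trans _ _ (\sum_(1 <= j < k)
      (emp_mass (dataset Z om) (level_error f j) + 3 * eta))).
    rewrite big_nat_cond [leRHS]big_nat_cond; apply: ler_sum => j /andP[/andP[_ jk] _].
    apply: level_error_deviation => // b wt /=.
    rewrite emp_hits ler_pdivlMr// -{2}(gtr0_norm n0R) -normrM mulrBl divfK ?gt_eqF//.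
    by rewrite (mulrC (mass _ _)); exact: devk.
  rewrite big_split/= lerD ?emp_margin_loss_ge//.
  rewrite sumr_const_nat -[leLHS]mulr_natl natrB// ler_wpM2l// subr_ge0 ler1n//.
have mfA a j : measurable [set z : obs R d a0 | (attr z == a) && (j < f (feat z))%N].
  exact: (@level_measurable R d A a0 k w th k2 sth (fun z => attr z == a) j
    (attr_measurable a)).
pose r := Num.sqrt (2 * L / (n%:R * beta)).
(* The factor 1 - r of the statement is positive because 2 L is below 48^2 * 40 (d + 1 + L) < n
   beta. *)
have r01 : 0 <= r < 1.
  rewrite sqrtr_ge0/= -(@expr_lt1 _ 2) ?sqrtr_ge0//.
  rewrite sqr_sqrtr ?divr_ge0 ?mulr_ge0 ?(ltW beta0) ?(le_trans _ L1)//.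
  rewrite ltr_pdivrMr// mul1r (le_lt_trans _ nX1)//.
  by have : 0 <= d.+1%:R :> R by []; lra.
have := parity_rate k0 nb (ler0n R d) L1 r01.
set del := 96 * _ => rate.
have del0 : 0 <= del by rewrite mulr_ge0 ?sqrtr_ge0.
apply: le_trans (DP_viol_le (P := P) (D := dataset Z om) fk mfA del0 _) _; last first.
  by rewrite lerD2l; exact: rate.
move=> a j jk; rewrite /level_freq !emp_hits.
set G := fun z : obs R d a0 => attr z == a.
set H := fun z : obs R d a0 => (attr z == a) && (j < f (feat z))%N.
(* Numerator and denominator of [level_freq] are both half-spaces of the group a, so [devA] controls
   both. *)
have [wt wtP] := level_halfspace w k2 sth G jk.
have [wt' wt'P] := group_halfspace w k2 sth G.
have devH := devA a wt; have devG := devA a wt'.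
rewrite /= -/G in devH devG.
rewrite (_ : halfspace G wt = H) in devH; last by apply/funext => z; rewrite -wtP.
rewrite (_ : halfspace G wt' = G) in devG; last by apply/funext => z; rewrite -wt'P.
have bn : n%:R * beta <= n%:R * mass P G by rewrite ler_pM2l// massA.
have HG : 0 <= hits Z H om <= hits Z G om.
  rewrite sumr_ge0//=; apply: ler_sum => i _; rewrite ler_nat /H -/(G _).
  by case: (G _); case: (j < _)%N.
have X0 : 0 <= d.+1%:R + L by rewrite addr_ge0// (le_trans _ L1).
have [hG0 ratio] := group_ratio_close nb bn X0 nX1 HG devH devG.
have -> : mass P H / mass P G = n%:R * mass P H / (n%:R * mass P G).
  by rewrite -mulf_div divff ?gt_eqF// mul1r.
have -> : hits Z H om / n%:R / (hits Z G om / n%:R) = hits Z H om / hits Z G om.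
  by field; rewrite !gt_eqF.
by apply: (le_trans ratio); rewrite /del -(natr1 d).
Qed.
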